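(* Let $W$ be a $\mathbb{Z}$-equivariant $\phi$-coordinated quasi $V_{\widetilde{\mathcal{A}}}(\ell_{12},0)$-module. Then $W$ is a restricted $\widetilde{V}_{q}$-module of level $\ell_{12}$ with $$\widetilde{E}_{k,m}(x)=Y_{W}(G_{k,m},x)\quad\text{for } k,m\in\mathbb{Z}.$$
   Context: All vector spaces are over $\mathbb{C}$, $q\in\mathbb{C}^{\times}$ is not a root of unity, and $\ell_1,\ell_2$ are complex numbers. The algebra of $q$-difference operators $\widetilde{V}_{q}$ is the Lie algebra spanned by $E_{k,l}$ ($(k,l)\in\mathbb{Z}^{2}$), $c_{1}$, $c_{2}$, with the convention $E_{0,0}=0$, where $c_{1},c_{2}$ are central and $$[E_{k,l},E_{r,s}]=(q^{rl-sk}-q^{sk-rl})E_{k+r,l+s}+\delta_{k,-r}\delta_{l,-s}(kc_{1}+lc_{2}).$$ A $\widetilde{V}_{q}$-module $W$ is restricted if for any $w\in W$, $k\in\mathbb{Z}$, $E_{k,l}w=0$ for $l$ sufficiently large; it is of level $\ell_{12}$ if $c_{1},c_{2}$ act as the scalars $\ell_{1},\ell_{2}$ respectively. Set $\widetilde{E}_{k,m}(x)=\sum_{l\in\mathbb{Z}}E_{k,l}(q^{m}x)^{-l}$ for $k,m\in\mathbb{Z}$. The Lie algebra $\mathcal{A}$: it has basis $G_{\alpha,m}$ ($\alpha,m\in\mathbb{Z}$), where $G_{\alpha,m}$ is the doubly infinite elementary matrix with entry 1 in position $(m+\alpha,m-\alpha)$, and bracket $$[G_{\alpha,m},G_{\beta,n}]=\delta_{\alpha+\beta,m-n}G_{\alpha+\beta,\alpha+n}-\delta_{\alpha+\beta,n-m}G_{\alpha+\beta,n-\alpha}.$$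 Put $\langle G_{\alpha,m},G_{\beta,n}\rangle=\delta_{\alpha+\beta,0}\delta_{m-n,0}$ (a symmetric invariant form) and $\psi(G_{\alpha,m},G_{\beta,n})=\alpha\delta_{\alpha+\beta,0}\delta_{m-n,0}$ (a 2-cocycle). The generalized affine Lie algebra is $\widetilde{\mathcal{A}}=\mathcal{A}\otimes\mathbb{C}[t,t^{-1}]\oplus\mathbb{C}K_{1}\oplus\mathbb{C}K_{2}$ with $K_{1},K_{2}$ central and $$[a\otimes t^{i},b\otimes t^{j}]=[a,b]\otimes t^{i+j}+\psi(a,b)\delta_{i+j+1,0}K_{1}+i\langle a,b\rangle\delta_{i+j,0}K_{2}.$$ The vertex algebra $V_{\widetilde{\mathcal{A}}}(\ell_{12},0)=U(\widetilde{\mathcal{A}})\otimes_{U(\mathcal{A}\otimes\mathbb{C}[t]+\mathbb{C}K_{1}+\mathbb{C}K_{2})}\mathbb{C}$, where $\mathcal{A}\otimes\mathbb{C}[t]$ acts trivially on $\mathbb{C}$ and $K_{i}$ acts as $\ell_{i}$; its vacuum vector is $\mathbf{1}=1\otimes1$, $\mathcal{A}$ is identified with a subspace through $a\mapsto a(-1)\mathbf{1}$ (with $a(n)=a\otimes t^{n}$), and the vertex algebra structure is the unique one with $Y(a,x)=\sum_{n\in\mathbb{Z}}a(n)x^{-n-1}$ for $a\in\mathcal{A}$. The group $\mathbb{Z}$ acts on $\widetilde{\mathcal{A}}$ by the automorphisms $\tau_{r}$ with $\tau_{r}(G_{k,m}\otimes t^{i})=G_{k,m+r}\otimes t^{i}$,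 $\tau_{r}(K_{j})=K_{j}$ ($r\in\mathbb{Z}$, $j=1,2$), and hence on $V_{\widetilde{\mathcal{A}}}(\ell_{12},0)$ by vertex algebra automorphisms, still denoted $\tau_r$. Let $\chi_{q}:\mathbb{Z}\to\mathbb{C}^{\times}$, $r\mapsto q^{r}$. Let $\phi=\phi(x,z)=xe^{z}\in\mathbb{C}((x))[[z]]$. For a vertex algebra $V$, a $\phi$-coordinated quasi $V$-module is a vector space $W$ with a linear map $Y_{W}(\cdot,x):V\to\mathrm{Hom}(W,W((x)))$ such that $Y_{W}(\mathbf{1},x)=1_{W}$ and for any $u,v\in V$ there is a nonzero polynomial $f(x_{1},x_{2})\in\mathbb{C}[x_1,x_2]$ with $$f(x_{1},x_{2})Y_{W}(u,x_{1})Y_{W}(v,x_{2})\in\mathrm{Hom}(W,W((x_{1},x_{2})))$$ and $$\big(f(x_{1},x_{2})Y_{W}(u,x_{1})Y_{W}(v,x_{2})\big)\big|_{x_{1}=x_{2}e^{z}}=f(x_{2}e^{z},x_{2})Y_{W}(Y(u,z)v,x_{2}).$$ For $V=V_{\widetilde{\mathcal{A}}}(\ell_{12},0)$, such a module is $\mathbb{Z}$-equivariant (with respect to $\chi_{q}$) if $Y_{W}(\tau_{r}v,x)=Y_{W}(v,q^{r}x)$ for all $r\in\mathbb{Z}$, $v\in V$, and for any $u,v\in V$ there is a polynomial $p(x_{1},x_{2})$, a finite product of factors $x_{1}-q^{r}x_{2}$ ($r\in\mathbb{Z}$), such that $p(x_{1},x_{2})Y_{W}(u,x_{1})Y_{W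}(v,x_{2})\in\mathrm{Hom}(W,W((x_{1},x_{2})))$.
   Formalization: Since E_{0,0}=0, the printed formula can fail in the constant term for k=0; the theorem proved gives Y_W(G_{k,m},x) = Ẽ_{k,m}(x) + δ_{k,0}ζ, with ζ an operator on W independent of x and m that commutes with the action of the q-difference algebra. *)

(* Defs.v *)
From HB Require Import structures.
From mathcomp Require Import all_boot all_order all_algebra.
From mathcomp Require Import finmap monalg complex.
From mathcomp Require Import boolp classical_sets fsbigop reals.

Set Implicit Arguments.
Unset Strict Implicit.
Unset Printing Implicit Defensive.

Import GRing.Theory.
Local Open Scope ring_scope.
Local Open Scope quotient_scope.

(* [{malg F[I]}] is the vector space with basis [bas i], i in [I]; [lext f] and
   [bilin f] are the linear and bilinear maps with prescribed values on it. *)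
HB.lock Definition bas (F : fieldType) (I : choiceType) (i : I) : {malg F[I]} :=
  << i >>.
Arguments bas {F I} i.

HB.lock Definition lext (F : fieldType) (I : choiceType) (L : lmodType F)
  (f : I -> L) (x : {malg F[I]}) : L := \sum_(i <- msupp x) x@_i *: f i.
Arguments lext {F I L} f x.

Section LinearExtension.
Context {F : fieldType}.

Definition bilin {I J : choiceType} {L : lmodType F} (f : I -> J -> L)
  (x : {malg F[I]}) (y : {malg F[J]}) : L := lext (fun i => lext (f i) y) x.

Lemma basE (I : choiceType) (i : I) : bas i = << i >> :> {malg F[I]}.
Proof. by rewrite bas.unlock. Qed.

Lemma lextE (I : choiceType) (L : lmodType F) (f : I -> L) (x : {malg F[I]}) :
  lext f x = \sum_(i <- msupp x) x@_i *: f i.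
Proof. by rewrite lext.unlock. Qed.

Lemma lextEw (I : choiceType) (L : lmodType F) (f : I -> L) (d : {fset I})
  (x : {malg F[I]}) :
  (msupp x `<=` d)%fset -> lext f x = \sum_(i <- d) x@_i *: f i.
Proof.
move=> le; rewrite lextE [LHS](big_fset_incl _ le) => //= i _ /mcoeff_outdom ->.
by rewrite scale0r.
Qed.

Lemma lext_is_linear (I : choiceType) (L : lmodType F) (f : I -> L) :
  linear (lext f).
Proof.
move=> c x y.
set d := (msupp (c *: x + y) `|` (msupp x `|` msupp y))%fset.
have sub z : z \in [:: c *: x + y; x; y] -> (msupp z `<=` d)%fset.
  move=> zs; apply/fsubsetP => k; rewrite /d !in_fsetU.
  by move: zs; rewrite !inE => /or3P[] /eqP-> ->; rewrite ?orbT.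
rewrite !(lextEw f (sub _ _)) ?inE ?eqxx ?orbT //.
rewrite scaler_sumr -big_split; apply: eq_bigr => i _ /=.
by rewrite mcoeffD mcoeffZ scalerDl scalerA.
Qed.

HB.instance Definition _ (I : choiceType) (L : lmodType F) (f : I -> L) :=
  GRing.isLinear.Build F {malg F[I]} L *:%R (lext f) (lext_is_linear f).

Lemma lextU (I : choiceType) (L : lmodType F) (f : I -> L) i :
  lext f (bas i) = f i.
Proof.
by rewrite basE (lextEw _ msuppU_le) big_seq_fset1 mcoeffUU scale1r.
Qed.

Lemma bilinU (I J : choiceType) (L : lmodType F) (f : I -> J -> L) i j :
  bilin f (bas i) (bas j) = f i j.
Proof. by rewrite /bilin !lextU. Qed.

Lemma bilin_linearl (I J : choiceType) (L : lmodType F) (f : I -> J -> L) y :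
  linear ((bilin f)^~ y).
Proof. by move=> c x x'; rewrite /bilin lext_is_linear. Qed.

Lemma bilin_linearr (I J : choiceType) (L : lmodType F) (f : I -> J -> L) x :
  linear (bilin f x).
Proof.
move=> c y y'; rewrite /bilin !(lextE (fun i => lext (f i) _)) scaler_sumr -big_split.
by apply: eq_bigr => i _; rewrite lext_is_linear scalerDr !scalerA mulrC.
Qed.

Lemma linear_ext (I : choiceType) (L : lmodType F) (f g : {malg F[I]} -> L) :
  linear f -> linear g -> (forall i, f (bas i) = g (bas i)) -> f =1 g.
Proof.
move=> fl gl fg x.
pose f' : {linear {malg F[I]} -> L} := HB.pack f (GRing.isLinear.Build _ _ _ _ f fl).
pose g' : {linear {malg F[I]} -> L} := HB.pack g (GRing.isLinear.Build _ _ _ _ g gl).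
rewrite -[f]/(f' : _ -> _) -[g]/(g' : _ -> _) [x]monalgE !linear_sum.
apply: eq_bigr => i _.
have -> : << x@_i *g i >> = x@_i *: bas i.
  by rewrite basE; apply/malgP => k; rewrite mcoeffZ !mcoeffU mulrnAr mulr1.
by rewrite !linearZ /= fg.
Qed.

Lemma mcoeff_bas (I : choiceType) (i j : I) : (bas i)@_j = (i == j)%:R :> F.
Proof. by rewrite basE mcoeffU. Qed.

End LinearExtension.

Section Quotient.
Context {F : fieldType} {V : lmodType F}.

Inductive lspan (P : V -> Prop) : V -> Prop :=
| lspan0 : lspan P 0
| lspanP c x y : P x -> lspan P y -> lspan P (c *: x + y).

Variable P : V -> Prop.

Lemma lspan_gen x : P x -> lspan P x.
Proof. by move=> Px; rewrite -[x]addr0 -[x]scale1r; apply: lspanP => //; apply: lspan0. Qed.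

Lemma lspanD x y : lspan P x -> lspan P y -> lspan P (x + y).
Proof.
move=> + Py; elim => [|c x' y' Px' _ IH]; first by rewrite add0r.
by rewrite -addrA; apply: lspanP.
Qed.

Lemma lspanZ c x : lspan P x -> lspan P (c *: x).
Proof.
elim=> [|c' x' y' Px' _ IH]; first by rewrite scaler0; apply: lspan0.
by rewrite scalerDr scalerA; apply: lspanP.
Qed.

Lemma lspanN x : lspan P x -> lspan P (- x).
Proof. by rewrite -scaleN1r; apply: lspanZ. Qed.

Definition quot_rel (x y : V) : bool := `[< lspan P (x - y) >].

Lemma quot_rel_equiv : equiv_class_of quot_rel.
Proof.
split=> [x|x y|y x z].
- by apply/asboolP; rewrite subrr; apply: lspan0.
- by apply/asboolP/asboolP => /lspanN; rewrite opprB.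
- move=> /asboolP xy /asboolP yz; apply/asboolP.
  by rewrite -[x](subrK y) -addrA; apply: lspanD.
Qed.

Canonical quot_equiv := EquivRelPack quot_rel_equiv.

(* The quotient of [V] by the subspace spanned by [P]. *)
Definition quot : Type := {eq_quot quot_equiv}.

HB.instance Definition _ := EqQuotient.on quot.
HB.instance Definition _ := Choice.on quot.

Lemma quot_eqP (x y : V) :
  (\pi_quot x = \pi_quot y) <-> lspan P (x - y).
Proof. by split=> [/eqquotP /asboolP|xy]; last apply/eqquotP/asboolP. Qed.

Lemma quot_repr (x : V) : lspan P (repr (\pi_quot x) - x).
Proof. by apply/quot_eqP; rewrite reprK. Qed.

Lemma quot_ind (K : quot -> Prop) :
  (forall x, K (\pi_quot x)) -> forall u, K u.
Proof. by move=> Kpi u; rewrite -[u]reprK. Qed.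

Definition quot_add (x y : quot) : quot := \pi_quot (repr x + repr y).
Definition quot_opp (x : quot) : quot := \pi_quot (- repr x).
Definition quot_scale (c : F) (x : quot) : quot := \pi_quot (c *: repr x).

Lemma pi_add x y : quot_add (\pi_quot x) (\pi_quot y) = \pi_quot (x + y).
Proof.
by apply/quot_eqP; rewrite opprD addrACA; apply: lspanD; apply: quot_repr.
Qed.

Lemma pi_opp x : quot_opp (\pi_quot x) = \pi_quot (- x).
Proof. by apply/quot_eqP; rewrite -opprD; apply/lspanN/quot_repr. Qed.

Lemma pi_scale c x : quot_scale c (\pi_quot x) = \pi_quot (c *: x).
Proof. by apply/quot_eqP; rewrite -scalerBr; apply/lspanZ/quot_repr. Qed.

Lemma quot_addA : associative quot_add.
Proof.
by do 3!elim/quot_ind=> ?; rewrite !pi_add addrA.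
Qed.

Lemma quot_addC : commutative quot_add.
Proof. by do 2!elim/quot_ind=> ?; rewrite !pi_add addrC. Qed.

Lemma quot_add0 : left_id (\pi_quot 0) quot_add.
Proof. by elim/quot_ind=> x; rewrite pi_add add0r. Qed.

Lemma quot_addN : left_inverse (\pi_quot 0) quot_opp quot_add.
Proof. by elim/quot_ind=> x; rewrite pi_opp pi_add addNr. Qed.

HB.instance Definition _ :=
  GRing.isZmodule.Build quot quot_addA quot_addC quot_add0 quot_addN.

Lemma quot_scaleA a b x :
  quot_scale a (quot_scale b x) = quot_scale (a * b) x.
Proof. by elim/quot_ind: x => x; rewrite !pi_scale scalerA. Qed.

Lemma quot_scale1 : left_id 1 quot_scale.
Proof. by elim/quot_ind=> x; rewrite pi_scale scale1r. Qed.

Lemma quot_scaleDr : right_distributive quot_scale +%R.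
Proof.
move=> c; elim/quot_ind=> x; elim/quot_ind=> y.
by rewrite [_ + _ in LHS]pi_add !pi_scale scalerDr [RHS]pi_add.
Qed.

Lemma quot_scaleDl x : {morph quot_scale^~ x : a b / a + b}.
Proof. by move=> a b; elim/quot_ind: x => x; rewrite !pi_scale scalerDl [RHS]pi_add. Qed.

HB.instance Definition _ := GRing.Zmodule_isLmodule.Build F quot
  quot_scaleA quot_scale1 quot_scaleDr quot_scaleDl.

Lemma quot_pi_linear : linear (\pi_quot : V -> quot).
Proof. by move=> c x y; rewrite -pi_add -pi_scale. Qed.

End Quotient.
Arguments quot {F V} P.

Section LieModule.
Context {F : fieldType} {L W : lmodType F}.

Record lie_module (br : L -> L -> L) (act : L -> W -> W) : Prop := LieModule {
  lie_module_linearl : forall w, linear (act^~ w);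
  lie_module_linearr : forall x, linear (act x);
  lie_module_bracket : forall x y w,
    act (br x y) w = act x (act y w) - act y (act x w)
}.

End LieModule.

Lemma mul_regroup (A : pzRingType) (a a' r b' b : A) :
  a * (a' * r * b') * b = a * a' * r * (b' * b).
Proof. by rewrite !mulrA. Qed.

Lemma mul_commutator (A : pzRingType) (a b u : A) :
  (a * b - b * a) * u = a * (b * u) - b * (a * u).
Proof. by rewrite mulrBl !mulrA. Qed.

Lemma map_commutator (A : pzRingType) (f : A -> A) :
  {morph f : a b / a - b} -> {morph f : a b / a * b} ->
  forall a b c, f (a * b - b * a - c) = f a * f b - f b * f a - f c.
Proof. by move=> fB fM a b c; rewrite !fB !fM. Qed.

Section Enveloping.
Context {F : fieldType} {L : lmodType F}.
Variable br : L -> L -> L.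

(* The free associative unital algebra on the underlying set of [L]. *)
Definition free_alg := {malg F[{fmonom L}]}.
Definition gen (x : L) : free_alg := bas (fmu x).

Lemma scale_mulr (c : F) (s t : free_alg) : s * (c *: t) = c *: (s * t).
Proof.
have cC : s * c%:MP = c *: s.
  rewrite [s in LHS]monalgE [s in RHS]monalgE mulr_suml scaler_sumr.
  apply: eq_bigr => w _; rewrite -mul_malgC !malgM_def !fgmulUU.
  by rewrite mulm1 mul1m mulrC.
by rewrite -mul_malgC mulrA cC scalerAl.
Qed.

Inductive env_rel : free_alg -> Prop :=
| env_rel_linear c x y : env_rel (gen (c *: x + y) - (c *: gen x + gen y))
| env_rel_bracket x y : env_rel (gen x * gen y - gen y * gen x - gen (br x y)).

Definition env_ideal (t : free_alg) : Prop :=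
  exists a r b, env_rel r /\ t = a * r * b.

(* The universal enveloping algebra. *)
Definition env : Type := quot env_ideal.

HB.instance Definition _ := GRing.Lmodule.on env.

Lemma env_idealM a b t : lspan env_ideal t -> lspan env_ideal (a * t * b).
Proof.
elim=> [|c x y [a' [r [b' [rP ->]]]] _ IH].
  by rewrite mulr0 mul0r; apply: lspan0.
rewrite mulrDr mulrDl scale_mulr -scalerAl; apply: lspanP => //.
exists (a * a'), r, (b' * b); split; [exact: rP | exact: mul_regroup].
Qed.

Definition env_pi (t : free_alg) : env := \pi_(quot env_ideal) t.

Lemma env_pi_eq s t : lspan env_ideal (s - t) -> env_pi s = env_pi t.
Proof. by move/quot_eqP. Qed.

Lemma env_ind (K : env -> Prop) : (forall t, K (env_pi t)) -> forall u, K u.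
Proof. exact: quot_ind. Qed.

Lemma env_pi_linear : linear env_pi.
Proof. exact: quot_pi_linear. Qed.

Lemma env_piD s t : env_pi (s + t) = env_pi s + env_pi t.
Proof. by have := env_pi_linear 1 s t; rewrite !scale1r. Qed.

Lemma env_piZ c t : env_pi (c *: t) = c *: env_pi t.
Proof. exact/esym/pi_scale. Qed.

Lemma env_piB s t : env_pi (s - t) = env_pi s - env_pi t.
Proof.
have := env_pi_linear (-1) t s.
by rewrite !scaleN1r [X in env_pi X]addrC [X in _ = X]addrC.
Qed.

Definition env_mul (u v : env) : env := env_pi (repr u * repr v).

Lemma env_pi_mul s t : env_mul (env_pi s) (env_pi t) = env_pi (s * t).
Proof.
rewrite {1}/env_mul; apply: env_pi_eq.
set s' := repr (env_pi s); set t' := repr (env_pi t).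
have -> : s' * t' - s * t = 1 * (s' - s) * t' + s * (t' - t) * 1.
  by rewrite mul1r mulr1 mulrBl mulrBr addrA subrK.
by apply: lspanD; apply: env_idealM; apply: quot_repr.
Qed.

Lemma env_mulA : associative env_mul.
Proof.
elim/env_ind=> s; elim/env_ind=> t; elim/env_ind=> r.
by rewrite !env_pi_mul mulrA.
Qed.

Lemma env_mul1l : left_id (env_pi 1) env_mul.
Proof. by elim/env_ind=> ?; rewrite env_pi_mul mul1r. Qed.

Lemma env_mul1r : right_id (env_pi 1) env_mul.
Proof. by elim/env_ind=> ?; rewrite env_pi_mul mulr1. Qed.

Lemma env_mulDl : left_distributive env_mul +%R.
Proof.
do 3!elim/env_ind=> ?.
by rewrite -env_piD !env_pi_mul mulrDl env_piD.
Qed.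

Lemma env_mulDr : right_distributive env_mul +%R.
Proof.
do 3!elim/env_ind=> ?.
by rewrite -env_piD !env_pi_mul mulrDr env_piD.
Qed.

HB.instance Definition _ := GRing.Zmodule_isPzRing.Build env
  env_mulA env_mul1l env_mul1r env_mulDl env_mulDr.

Lemma env_piM s t : env_pi (s * t) = env_pi s * env_pi t.
Proof. exact/esym/env_pi_mul. Qed.

Lemma env_scaleAl (c : F) (u v : env) : c *: (u * v) = (c *: u) * v.
Proof.
elim/env_ind: u => s; elim/env_ind: v => t.
by rewrite -env_piM -!env_piZ -env_piM -scalerAl.
Qed.

Lemma env_scaleAr (c : F) (u v : env) : c *: (u * v) = u * (c *: v).
Proof.
elim/env_ind: u => s; elim/env_ind: v => t.
by rewrite -env_piM -!env_piZ -env_piM scale_mulr.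
Qed.

Definition env_in (x : L) : env := env_pi (gen x).

Lemma env_in_linear : linear env_in.
Proof.
move=> c x y; rewrite /env_in -env_piZ -env_piD; apply/env_pi_eq/lspan_gen.
by exists 1, (gen (c *: x + y) - (c *: gen x + gen y)), 1; split;
  [left | rewrite mul1r mulr1].
Qed.

Lemma env_in_bracket x y :
  env_in (br x y) = env_in x * env_in y - env_in y * env_in x.
Proof.
apply/eqP; rewrite -subr_eq0 -opprB oppr_eq0 subr_eq0; apply/eqP.
have -> : env_in x * env_in y - env_in y * env_in x
        = env_pi (gen x * gen y - gen y * gen x).
  rewrite /env_in -(env_piM (gen x) (gen y)) -(env_piM (gen y) (gen x)).
  exact/esym/env_piB.
apply/env_pi_eq/lspan_gen.
by exists 1, (gen x * gen y - gen y * gen x - gen (br x y)), 1; split;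
  [right | rewrite mul1r mulr1].
Qed.

Section Induced.
Variables (b : L -> Prop) (chi : L -> F).

Definition induced_rel (u : env) : Prop :=
  exists v x, b x /\ u = v * (env_in x - chi x *: (1 : env)).

(* For a subalgebra [b] of [L] and a character [chi] of [b], the tensor product
   U(L) (x)_{U(b)} F_chi: since U(b) is generated by [b], it is the quotient of
   U(L) (x) F = U(L) by the span of the elements u x - chi(x) u, x in [b]. *)
Definition induced : Type := quot induced_rel.

HB.instance Definition _ := GRing.Lmodule.on induced.

Definition induced_pi (u : env) : induced := \pi_(quot induced_rel) u.

Definition vac : induced := induced_pi 1.

Definition induced_act (x : L) (v : induced) : induced :=
  induced_pi (env_in x * repr v).

Lemma induced_ind (K : induced -> Prop) :
  (forall u, K (induced_pi u)) -> forall v, K v.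
Proof. exact: quot_ind. Qed.

Lemma induced_pi_linear : linear induced_pi.
Proof. exact: quot_pi_linear. Qed.

Lemma induced_pi_eq u v :
  lspan induced_rel (u - v) -> induced_pi u = induced_pi v.
Proof. by move/quot_eqP. Qed.

Lemma induced_piB u v : induced_pi (u - v) = induced_pi u - induced_pi v.
Proof.
have := induced_pi_linear (-1) v u.
by rewrite !scaleN1r [X in induced_pi X]addrC [X in _ = X]addrC.
Qed.

Lemma induced_relM u v : lspan induced_rel v -> lspan induced_rel (u * v).
Proof.
elim=> [|c x y [u' [z [bz ->]]] _ IH]; first by rewrite mulr0; apply: lspan0.
rewrite mulrDr -env_scaleAr; apply: lspanP => //.
by exists (u * u'), z; rewrite mulrA.
Qed.

Lemma induced_actE x u :
  induced_act x (induced_pi u) = induced_pi (env_in x * u).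
Proof.
by apply: induced_pi_eq; rewrite -mulrBr; apply/induced_relM/quot_repr.
Qed.

Lemma induced_lie_module : lie_module br induced_act.
Proof.
split.
- elim/induced_ind=> u c x y; rewrite !induced_actE env_in_linear mulrDl.
  by rewrite -env_scaleAl induced_pi_linear.
- move=> x c; elim/induced_ind=> u; elim/induced_ind=> v.
  rewrite [X in induced_act x X](_ : _ = induced_pi (c *: u + v)); last first.
    exact/esym/induced_pi_linear.
  rewrite (induced_actE x (c *: u + v)) (induced_actE x u) (induced_actE x v).
  rewrite mulrDr -env_scaleAr.
  exact: induced_pi_linear.
- move=> x y; elim/induced_ind=> u; rewrite !induced_actE env_in_bracket.
  by rewrite mul_commutator; apply: induced_piB.
Qed.

Lemma induced_vac x : b x -> induced_act x vac = chi x *: vac.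
Proof.
move=> bx; rewrite induced_actE mulr1.
have -> : chi x *: vac = induced_pi (chi x *: (1 : env)).
  by rewrite -[RHS]pi_scale.
apply/induced_pi_eq/lspan_gen.
by exists 1, x; rewrite mul1r.
Qed.

End Induced.
End Enveloping.
#[global] Opaque env_pi env_mul induced_pi induced_act.
Arguments env {F L} br.
Arguments induced {F L} br b chi.
Arguments vac {F L} br b chi.
Arguments induced_act {F L} br b chi x v.

Section Functoriality.
Context {F : fieldType} {L : lmodType F}.
Variables (br : L -> L -> L) (g : L -> L).

Definition free_map : free_alg -> free_alg :=
  lext (fun w : {fmonom L} => \prod_(x <- (w : seq L)) (gen (g x) : free_alg)).

HB.instance Definition _ := GRing.isLinear.Build F free_alg free_alg *:%R
  free_map (lext_is_linear _).

Definition env_map (u : env br) : env br := env_pi br (free_map (repr u)).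

Lemma free_map_lin : linear free_map.
Proof. exact: lext_is_linear. Qed.

Lemma free_mapB s t : free_map (s - t) = free_map s - free_map t.
Proof. exact: linearB. Qed.

Lemma free_map_gen x : free_map (gen x) = gen (g x).
Proof. by rewrite /free_map lextU fmuE big_seq1. Qed.

Lemma free_map1 : free_map 1 = 1.
Proof.
transitivity (free_map (bas mone)); first by rewrite basE.
rewrite /free_map lextU; have -> : (mone : {fmonom L}) = FMonom [::] := fmoneE L.
by rewrite big_nil.
Qed.

Lemma free_mapM s t : free_map (s * t) = free_map s * free_map t.
Proof.
apply: (linear_ext (f := fun s : free_alg => free_map (s * t))
                   (g := fun s => free_map s * free_map t)).
- by move=> c x y; rewrite mulrDl -scalerAl linearP.
- by move=> c x y; rewrite linearP mulrDl -scalerAl.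
move=> v.
apply: (linear_ext (f := fun t : free_alg => free_map (bas v * t))
                   (g := fun t => free_map (bas v) * free_map t)).
- by move=> c x y; rewrite mulrDr scale_mulr linearP.
- by move=> c x y; rewrite linearP mulrDr scale_mulr.
move=> w; have -> : (bas v : free_alg) * bas w = bas (mmul v w).
  by rewrite malgM_def !basE fgmulUU mulr1.
rewrite /free_map !lextU.
by have -> : mmul v w = FMonom (v ++ w) := fmmulE v w; rewrite big_cat.
Qed.

(* [env_map] and [induced_map] have their intended meaning when [g] is a Lie
   algebra endomorphism preserving [b] and [chi]; see the lemmas below. *)
Hypothesis g_linear : linear g.
Hypothesis g_bracket : forall x y, g (br x y) = br (g x) (g y).

Lemma env_ideal_map t :
  lspan (env_ideal br) t -> lspan (env_ideal br) (free_map t).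
Proof.
elim=> [|c x y [a [r [d [rP ->]]]] _ IH].
  by rewrite linear0; apply: lspan0.
rewrite free_map_lin; apply: lspanP => //.
exists (free_map a), (free_map r), (free_map d).
split; last by rewrite free_mapM free_mapM.
case: rP => [c' x' y'|x' y'].
  rewrite free_mapB free_map_lin !free_map_gen g_linear; exact: env_rel_linear.
rewrite (map_commutator free_mapB free_mapM).
rewrite (free_map_gen x') (free_map_gen y') (free_map_gen (br x' y')) g_bracket.
exact: env_rel_bracket.
Qed.

Lemma env_mapE t : env_map (env_pi br t) = env_pi br (free_map t).
Proof.
by apply: env_pi_eq; rewrite -free_mapB; apply/env_ideal_map/quot_repr.
Qed.

Lemma env_map_linear : linear env_map.
Proof.
move=> c u v; elim/(@env_ind _ _ br): u => s; elim/(@env_ind _ _ br): v => t.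
rewrite [X in env_map X](_ : _ = env_pi br (c *: s + t)); last first.
  exact/esym/env_pi_linear.
rewrite (env_mapE (c *: s + t)) (env_mapE s) (env_mapE t) free_map_lin.
exact: env_pi_linear.
Qed.

Lemma env_mapM u v : env_map (u * v) = env_map u * env_map v.
Proof.
elim/(@env_ind _ _ br): u => s; elim/(@env_ind _ _ br): v => t.
by rewrite -env_piM !env_mapE free_mapM env_piM.
Qed.

Lemma env_map1 : env_map 1 = 1.
Proof. by rewrite [in LHS]env_mapE free_map1. Qed.

Lemma env_map_in x : env_map (env_in br x) = env_in br (g x).
Proof. by rewrite env_mapE free_map_gen. Qed.

End Functoriality.
#[global] Opaque free_map env_map.

Section InducedMap.
Context {F : fieldType} {L : lmodType F}.
Variables (br : L -> L -> L) (b : L -> Prop) (chi : L -> F) (g : L -> L).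

Definition induced_map (v : induced br b chi) : induced br b chi :=
  induced_pi b chi (env_map g (repr v)).

Hypothesis g_linear : linear g.
Hypothesis g_bracket : forall x y, g (br x y) = br (g x) (g y).
Hypothesis g_b : forall x, b x -> b (g x).
Hypothesis g_chi : forall x, b x -> chi (g x) = chi x.

Lemma induced_mapE u :
  induced_map (induced_pi b chi u) = induced_pi b chi (env_map g u).
Proof.
have lin := env_map_linear g_linear g_bracket.
have map0 : env_map g 0 = 0 :> env br.
  by have := lin (-1) 0 0; rewrite !scaleN1r !addNr.
have map_rel v : lspan (induced_rel b chi) v ->
    lspan (induced_rel b chi) (env_map g v : env br).
  elim=> [|c x y [v' [z [bz ->]]] _ IH]; first by rewrite map0; apply: lspan0.
  rewrite lin; apply: lspanP => //.
  exists (env_map g v'), (g z); split; first exact: g_b.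
  rewrite (env_mapM g_linear g_bracket v').
  have -> // : env_map g (env_in br z - chi z *: (1 : env br))
            = env_in br (g z) - chi (g z) *: (1 : env br).
  rewrite g_chi // addrC -scaleNr lin (env_map1 g_linear g_bracket).
  by rewrite (env_map_in g_linear g_bracket z) scaleNr addrC.
apply: induced_pi_eq.
have -> : env_map g (repr (induced_pi b chi u)) - env_map g u
        = env_map g (repr (induced_pi b chi u) - u) :> env br.
  by rewrite [in RHS]addrC -[- u]scaleN1r lin scaleN1r addrC.
exact/map_rel/quot_repr.
Qed.

Lemma induced_map_linear : linear induced_map.
Proof.
move=> c; elim/(@induced_ind _ _ br b chi)=> u.
elim/(@induced_ind _ _ br b chi)=> v.
rewrite -(induced_pi_linear b chi c u v) (induced_mapE (c *: u + v)).
rewrite (induced_mapE u) (induced_mapE v) env_map_linear //.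
exact: induced_pi_linear.
Qed.

Lemma induced_map_vac : induced_map (vac br b chi) = vac br b chi.
Proof. by rewrite induced_mapE env_map1. Qed.

Lemma induced_map_act x v :
  induced_map (induced_act br b chi x v)
  = induced_act br b chi (g x) (induced_map v).
Proof.
elim/(@induced_ind _ _ br b chi): v => u.
rewrite (induced_actE b chi x u) (induced_mapE (env_in br x * u)).
rewrite (induced_mapE u) (induced_actE b chi (g x) (env_map g u)).
by rewrite (env_mapM g_linear g_bracket) (env_map_in g_linear g_bracket).
Qed.

End InducedMap.
#[global] Opaque induced_map.

Section LieAlgebras.
Context {F : fieldType}.

(* The Lie algebra A, with basis G_{alpha,m} indexed by the pairs (alpha, m). *)
Definition algA := {malg F[(int * int)%type]}.
Definition G (alpha m : int) : algA := bas (alpha, m).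

Definition brA : algA -> algA -> algA :=
  bilin (fun a b : int * int => let: (alpha, m) := a in let: (beta, n) := b in
    (alpha + beta == m - n)%:R *: G (alpha + beta) (alpha + n)
    - (alpha + beta == n - m)%:R *: G (alpha + beta) (n - alpha)).

Definition formA : algA -> algA -> F :=
  bilin (L := F^o) (fun a b : int * int => let: (alpha, m) := a in let: (beta, n) := b in
    ((alpha + beta == 0) && (m - n == 0))%:R).

Definition psiA : algA -> algA -> F :=
  bilin (L := F^o) (fun a b : int * int => let: (alpha, m) := a in let: (beta, n) := b in
    alpha%:~R * ((alpha + beta == 0) && (m - n == 0))%:R).

(* The basis of A (x) F[t, t^-1] + F K1 + F K2: [inl (alpha, m, i)] stands for
   G_{alpha,m} (x) t^i, [inr false] for K1 and [inr true] for K2. *)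
Definition affA := {malg F[((int * int * int) + bool)%type]}.
Definition K1 : affA := bas (inr false).
Definition K2 : affA := bas (inr true).
Definition tens (a : algA) (i : int) : affA :=
  lext (fun g : int * int => bas (inl (g.1, g.2, i)) : affA) a.

Definition br_affA : affA -> affA -> affA :=
  bilin (fun a b => match a, b with
    | inl (alpha, m, i), inl (beta, n, j) =>
        tens (brA (G alpha m) (G beta n)) (i + j)
        + (psiA (G alpha m) (G beta n) * (i + j + 1 == 0)%:R) *: K1
        + (i%:~R * formA (G alpha m) (G beta n) * (i + j == 0)%:R) *: K2
    | _, _ => 0
    end).

(* Membership in the subalgebra A (x) F[t] + F K1 + F K2. *)
Definition affA_nneg (x : affA) : Prop :=
  forall alpha m i, inl (alpha, m, i) \in msupp x -> 0 <= i.

(* The character of this subalgebra killing A (x) F[t], with Ki |-> li. *)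
Definition affA_char (l1 l2 : F) : affA -> F :=
  lext (L := F^o) (fun k => match k with
    | inl _ => 0
    | inr false => l1
    | inr true => l2
    end).

Definition tau (r : int) : affA -> affA :=
  lext (fun k => match k with
    | inl (alpha, m, i) => bas (inl (alpha, m + r, i))
    | inr _ => bas k
    end : affA).

Definition VA (l1 l2 : F) : Type :=
  induced br_affA affA_nneg (affA_char l1 l2).

HB.instance Definition _ l1 l2 := GRing.Lmodule.on (VA l1 l2).

Definition VA_vac l1 l2 : VA l1 l2 := vac br_affA affA_nneg (affA_char l1 l2).

Definition VA_act l1 l2 (x : affA) (v : VA l1 l2) : VA l1 l2 :=
  induced_act br_affA affA_nneg (affA_char l1 l2) x v.

Definition VA_in l1 l2 (a : algA) : VA l1 l2 := VA_act (tens a (-1)) (VA_vac l1 l2).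

Definition VA_tau l1 l2 (r : int) (v : VA l1 l2) : VA l1 l2 :=
  induced_map (tau r) v.

(* The basis of the algebra of q-difference operators: [inl (k, l)] with
   (k, l) <> (0, 0) stands for E_{k,l}, [inr false] for c1, [inr true] for c2. *)
Definition qdiff := {malg F[({kl : int * int | kl != (0, 0)} + bool)%type]}.
Definition E (k l : int) : qdiff :=
  if insub (k, l) is Some kl then bas (inl kl) else 0.
Definition c1 : qdiff := bas (inr false).
Definition c2 : qdiff := bas (inr true).

Definition br_qdiff (q : F) : qdiff -> qdiff -> qdiff :=
  bilin (fun a b => match a, b with
    | inl kl, inl rs =>
        let: (k, l) := val kl in let: (r, s) := val rs in
        (q ^ (r * l - s * k) - q ^ (s * k - r * l)) *: E (k + r) (l + s)
        + ((k == - r) && (l == - s))%:R *: (k%:~R *: c1 + l%:~R *: c2)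
    | _, _ => 0
    end).

Lemma E00 : E 0 0 = 0.
Proof. by rewrite /E insubF. Qed.

Section Restricted.
Context {W : lmodType F}.

Record restricted_qdiff_module (q l1 l2 : F) (act : qdiff -> W -> W) : Prop :=
  RestrictedQdiffModule {
  qdiff_lie_module : lie_module (br_qdiff q) act;
  qdiff_restricted :
    forall w k, exists N : int, forall l, N <= l -> act (E k l) w = 0;
  qdiff_level1 : forall w, act c1 w = l1 *: w;
  qdiff_level2 : forall w, act c2 w = l2 *: w
}.

(* The coefficient of x^n in sum_l E_{k,l} (q^m x)^{-l}; it is 0 for
   (k, n) = (0, 0), as [E 0 0 = 0]. *)
Definition Etilde (q : F) (act : qdiff -> W -> W) (k m n : int) (w : W) : W :=
  (q ^ m) ^ n *: act (E k (- n)) w.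

End Restricted.
End LieAlgebras.
Arguments algA F : clear implicits.
Arguments affA F : clear implicits.
Arguments qdiff F : clear implicits.

Section Tau.
Context {F : fieldType} (l1 l2 : F) (r : int).

Lemma tau_linear : linear (@tau F r).
Proof. exact: lext_is_linear. Qed.

Lemma tens_linear i : linear (@tens F ^~ i).
Proof. by move=> c x y; apply: lext_is_linear. Qed.

Lemma tensG alpha m i : tens (G alpha m) i = bas (inl (alpha, m, i)) :> affA F.
Proof. exact: lextU. Qed.

Lemma tau_inl alpha m i :
  tau r (bas (inl (alpha, m, i))) = bas (inl (alpha, m + r, i)) :> affA F.
Proof. exact: lextU. Qed.

Lemma tau_inr b : tau r (bas (inr b)) = bas (inr b) :> affA F.
Proof. exact: lextU. Qed.

Lemma affA_char_inl k : affA_char l1 l2 (bas (inl k)) = 0.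
Proof. exact: (lextU (L := F^o)). Qed.

Lemma affA_char_linear :
  linear (affA_char l1 l2 : affA F -> F^o).
Proof. exact: lext_is_linear. Qed.

Lemma tau_tensG alpha m i :
  tau r (tens (G alpha m) i) = tens (G alpha (m + r)) i :> affA F.
Proof. by rewrite !tensG tau_inl. Qed.

Lemma tauK1 : tau r (K1 : affA F) = K1. Proof. exact: lextU. Qed.
Lemma tauK2 : tau r (K2 : affA F) = K2. Proof. exact: lextU. Qed.

Lemma tau_char x : affA_char l1 l2 (@tau F r x) = affA_char l1 l2 x.
Proof.
apply: (linear_ext (L := F^o) (f := fun x => affA_char l1 l2 (@tau F r x))
         (g := affA_char l1 l2)) => [c y z||[[[alpha m] i]|k]].
- by rewrite tau_linear affA_char_linear.
- exact: affA_char_linear.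
- by rewrite tau_inl (affA_char_inl (alpha, m, i)) affA_char_inl.
- by rewrite tau_inr.
Qed.

Lemma mcoeff_tau x alpha m i :
  (@tau F r x)@_(inl (alpha, m + r, i)) = x@_(inl (alpha, m, i)).
Proof.
apply: (linear_ext (L := F^o)
  (f := fun x => (@tau F r x)@_(inl (alpha, m + r, i)))
  (g := fun x => x@_(inl (alpha, m, i)))) => [c y z|c y z|[[[a n] j]|k]].
- by rewrite tau_linear mcoeffD mcoeffZ.
- by rewrite mcoeffD mcoeffZ.
- rewrite tau_inl !mcoeff_bas; congr (_%:R).
  rewrite !(inj_eq (@inl_inj _ _)) !xpair_eqE.
  by rewrite (inj_eq (addIr r)).
- by rewrite tau_inr !mcoeff_bas.
Qed.

Lemma tau_nneg x : affA_nneg x -> affA_nneg (@tau F r x).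
Proof.
move=> x_ge0 alpha m i; rewrite -mcoeff_neq0.
by rewrite -[m](subrK r) mcoeff_tau mcoeff_neq0 => /x_ge0.
Qed.

Lemma brA_G alpha m beta n : brA (G alpha m) (G beta n) =
  (alpha + beta == m - n)%:R *: G (alpha + beta) (alpha + n)
  - (alpha + beta == n - m)%:R *: G (alpha + beta) (n - alpha) :> algA F.
Proof. exact: bilinU. Qed.

Lemma formA_G alpha m beta n :
  formA (G alpha m) (G beta n) = ((alpha + beta == 0) && (m - n == 0))%:R :> F.
Proof. exact: (bilinU (L := F^o)). Qed.

Lemma psiA_G alpha m beta n : psiA (G alpha m) (G beta n) =
  alpha%:~R * ((alpha + beta == 0) && (m - n == 0))%:R :> F.
Proof. exact: (bilinU (L := F^o)). Qed.

Lemma br_affA_tensG alpha m i beta n j :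
  br_affA (tens (G alpha m) i) (tens (G beta n) j) =
  tens (brA (G alpha m) (G beta n)) (i + j)
  + (psiA (G alpha m) (G beta n) * (i + j + 1 == 0)%:R) *: K1
  + (i%:~R * formA (G alpha m) (G beta n) * (i + j == 0)%:R) *: K2 :> affA F.
Proof. by rewrite !tensG /br_affA bilinU. Qed.

Lemma tau_bracket x y :
  tau r (br_affA x y) = br_affA (tau r x) (tau r y) :> affA F.
Proof.
have linl z : linear ((@br_affA F)^~ z) := bilin_linearl _ z.
have linr z : linear (@br_affA F z) := bilin_linearr _ z.
have kl (b : bool) z : br_affA (bas (inr b)) z = 0 :> affA F.
  apply: (linear_ext (g := fun=> 0)) => [|c u v|k]; first exact: linr.
  - by rewrite scaler0 addr0.
  - by rewrite /br_affA bilinU.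
have kr (b : bool) z : br_affA z (bas (inr b)) = 0 :> affA F.
  apply: (linear_ext (f := (@br_affA F)^~ (bas (inr b))) (g := fun=> 0)).
  - exact: linl.
  - by move=> c u v; rewrite scaler0 addr0.
  - by move=> [[[? ?] ?]|?]; rewrite /br_affA bilinU.
have tau0 : tau r 0 = 0 :> affA F.
  by have := tau_linear (-1) 0 0; rewrite !scaleN1r !addNr.
apply: (linear_ext (f := fun x => tau r (br_affA x y))
                   (g := fun x => br_affA (tau r x) (tau r y))).
- by move=> c u v; rewrite linl tau_linear.
- by move=> c u v; rewrite tau_linear linl.
move=> [[[alpha m] i]|b]; last first.
  by rewrite tau_inr (kl b y) (kl b (tau r y)).
apply: (linear_ext (f := fun y => tau r (br_affA _ y))
                   (g := fun y => br_affA _ (tau r y))).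
- by move=> c u v; rewrite linr tau_linear.
- by move=> c u v; rewrite tau_linear linr.
move=> [[[beta n] j]|b]; last first.
  by rewrite tau_inr !(kr b).
rewrite -!tensG !tau_tensG !br_affA_tensG !brA_G !formA_G !psiA_G.
have sub_r u v : u + r - (v + r) = u - v by rewrite opprD addrACA subrr addr0.
rewrite !sub_r.
have tauD u v : tau r (u + v) = tau r u + tau r v :> affA F.
  by have := tau_linear 1 u v; rewrite !scale1r.
have tauZ c u : tau r (c *: u) = c *: tau r u :> affA F.
  by have := tau_linear c u 0; rewrite tau0 !addr0.
have split3 u a b : tau r (u + a *: K1 + b *: K2)
    = tau r u + a *: K1 + b *: K2 :> affA F.
  by rewrite tauD tauD tauZ tauZ tauK1 tauK2.
apply: etrans (split3 _ _ _) _.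
apply: (congr1 (fun u => u + _ *: K1 + _ *: K2)).
have tens_sub c d u v k :
    tens (c *: u - d *: v) k = c *: tens u k - d *: tens v k :> affA F.
  have e := tens_linear k c u (- d *: v); rewrite scaleNr in e; rewrite e.
  have t0 : tens 0 k = 0 :> affA F.
    by have := tens_linear k (-1) 0 0; rewrite !scaleN1r !addNr.
  by have := tens_linear k (- d) v 0; rewrite t0 !addr0 !scaleNr => ->.
have tau_sub c d u v :
    tau r (c *: u - d *: v) = c *: tau r u - d *: tau r v :> affA F.
  by rewrite -!scaleNr tauD !tauZ.
apply: etrans (congr1 (tau r) (tens_sub _ _ _ _ _)) _.
apply: etrans (tau_sub _ _ _ _) _; apply: etrans (esym (tens_sub _ _ _ _ _)).
rewrite (tau_tensG (alpha + beta) (alpha + n)).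
rewrite (tau_tensG (alpha + beta) (n - alpha)).
have -> : alpha + n + r = alpha + (n + r) by rewrite addrA.
have -> : n - alpha + r = n + r - alpha by rewrite addrAC.
reflexivity.
Qed.

Lemma VA_tau_linear : linear (@VA_tau F l1 l2 r).
Proof.
exact: (induced_map_linear tau_linear tau_bracket tau_nneg
         (fun x _ => tau_char x)).
Qed.

Lemma VA_tau_vac : VA_tau r (VA_vac l1 l2) = VA_vac l1 l2.
Proof.
exact: (induced_map_vac tau_linear tau_bracket tau_nneg
         (fun x _ => tau_char x)).
Qed.

Lemma VA_tau_act x (v : VA l1 l2) :
  VA_tau r (VA_act x v) = VA_act (tau r x) (VA_tau r v).
Proof.
exact: (induced_map_act tau_linear tau_bracket tau_nneg
         (fun x _ => tau_char x)).
Qed.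

End Tau.

Section VAProperties.
Context {F : fieldType} (l1 l2 : F).

Lemma VA_lie_module : lie_module (@br_affA F) (@VA_act F l1 l2).
Proof. exact: induced_lie_module. Qed.

Lemma VA_act_vac x :
  affA_nneg x -> VA_act x (VA_vac l1 l2) = affA_char l1 l2 x *: VA_vac l1 l2.
Proof. exact: induced_vac. Qed.

Lemma VA_K1_vac : VA_act K1 (VA_vac l1 l2) = l1 *: VA_vac l1 l2.
Proof.
rewrite VA_act_vac => [|alpha m i]; last by rewrite -mcoeff_neq0 mcoeff_bas eqxx.
by congr (_ *: _); exact: (lextU (L := F^o)).
Qed.

Lemma VA_K2_vac : VA_act K2 (VA_vac l1 l2) = l2 *: VA_vac l1 l2.
Proof.
rewrite VA_act_vac => [|alpha m i]; last by rewrite -mcoeff_neq0 mcoeff_bas eqxx.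
by congr (_ *: _); exact: (lextU (L := F^o)).
Qed.

Lemma VA_tens_vac alpha m (n : nat) :
  VA_act (tens (G alpha m) n%:Z) (VA_vac l1 l2) = 0.
Proof.
rewrite VA_act_vac ?tensG ?affA_char_inl ?scale0r // => a b i.
rewrite -mcoeff_neq0 mcoeff_bas => ne0.
case: (inl (alpha, m, n%:Z) =P inl (a, b, i)) ne0 => [|_]; last by rewrite eqxx.
by move=> -[_ _ <-].
Qed.

End VAProperties.

Section VertexAlgebra.
Context {F : fieldType} {V : lmodType F}.

Definition binz (p : int) (i : nat) : F :=
  (\prod_(j < i) (p - j%:Z)%:~R) / (i`!)%:R.

(* [Y u n v] is u_n v, where Y(u, x) v = sum_n u_n v x^{-n-1}.  The last field is
   the Jacobi identity in components; its sums have finite support. *)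
Record vertex_algebra (vac : V) (Y : V -> int -> V -> V) : Prop :=
  VertexAlgebra {
  va_linearl : forall n v, linear (fun u => Y u n v);
  va_linearr : forall u n, linear (Y u n);
  va_trunc : forall u v, exists N : int, forall n, N <= n -> Y u n v = 0;
  va_vac : forall n v, Y vac n v = if n == -1 then v else 0;
  va_creation : forall u (n : nat), Y u n%:Z vac = 0;
  va_creation1 : forall u, Y u (-1) vac = u;
  va_jacobi : forall u v w (p q r : int),
    \sum_(i \in [set: nat])
       binz p i *: Y (Y u (r + i%:Z) v) (p + q - i%:Z) w
    = \sum_(i \in [set: nat])
       ((-1) ^+ i * binz r i) *:
         (Y u (p + r - i%:Z) (Y v (q + i%:Z) w)
          - (-1) ^ r *: Y v (q + r - i%:Z) (Y u (p + i%:Z) w))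
}.

End VertexAlgebra.

Section PhiCoordinated.
Context {F : fieldType} {W : lmodType F}.

(* A series a(x) = sum_n a_n x^n in Hom(W, W((x))) is given by [a n w] = a_n w. *)
Definition field1 (a : int -> W -> W) : Prop :=
  (forall n, linear (a n)) /\
  (forall w, exists N : int, forall n, n < N -> a n w = 0).

(* A(x1, x2) = sum_{m, n} A_{m,n} x1^m x2^n belongs to Hom(W, W((x1, x2))). *)
Definition field2 (A : int -> int -> W -> W) : Prop :=
  (forall m n, linear (A m n)) /\
  (forall w, exists N : int, forall m n, (m < N) || (n < N) -> A m n w = 0).

Definition comp2 (a b : int -> W -> W) : int -> int -> W -> W :=
  fun m n w => a m (b n w).

(* In {poly {poly F}} the outer variable is x1 and the inner one is x2; so
   [f`_i`_j] is the coefficient of x1^i x2^j. *)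
Definition mul2 (f : {poly {poly F}}) (A : int -> int -> W -> W) :
    int -> int -> W -> W :=
  fun m n w => \sum_(i < size f) \sum_(j < size f`_i)
    f`_i`_j *: A (m - i%:Z) (n - j%:Z) w.

(* The coefficient of z^a in e^{mz}. *)
Definition expz (m : int) (a : nat) : F := m%:~R ^+ a / (a`!)%:R.

(* The coefficient of z^k x2^s in A(x2 e^z, x2) w.  For A in
   Hom(W, W((x1, x2))) the sum has finite support. *)
Definition subst_exp (A : int -> int -> W -> W) (k s : int) (w : W) : W :=
  if k is Posz a then \sum_(m \in [set: int]) expz m a *: A m (s - m) w else 0.

(* The coefficient of z^k x2^s in f(x2 e^z, x2) H(z, x2) w, where [H k s w] is
   the coefficient of z^k x2^s in H(z, x2) w.  The inner sum has finite support
   if H(z, x2) w has only finitely many negative powers of z. *)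
Definition mul_exp (f : {poly {poly F}}) (H : int -> int -> W -> W)
    (k s : int) (w : W) : W :=
  \sum_(i < size f) \sum_(j < size f`_i)
    f`_i`_j *: \sum_(a \in [set: nat])
      expz i%:Z a *: H (k - a%:Z) (s - i%:Z - j%:Z) w.

Context {V : lmodType F}.

(* [YW v n w] is the coefficient of x^n in Y_W(v, x) w. *)
Record phi_quasi_module (vac : V) (Y : V -> int -> V -> V)
    (YW : V -> int -> W -> W) : Prop := PhiQuasiModule {
  phi_linear : forall n w, linear (fun v => YW v n w);
  phi_field : forall v, field1 (YW v);
  phi_vac : forall n w, YW vac n w = if n == 0 then w else 0;
  phi_assoc : forall u v, exists f : {poly {poly F}},
    [/\ f != 0,
        field2 (mul2 f (comp2 (YW u) (YW v)))
      & forall k s w,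
        subst_exp (mul2 f (comp2 (YW u) (YW v))) k s w
        = mul_exp f (fun k s => YW (Y u (- k - 1) v) s) k s w]
}.

Record equivariant (q : F) (tau : int -> V -> V) (YW : V -> int -> W -> W) :
    Prop := Equivariant {
  equivariant_tau : forall r v n w, YW (tau r v) n w = (q ^ r) ^ n *: YW v n w;
  equivariant_local : forall u v, exists rs : seq int,
    field2 (mul2 (\prod_(r <- rs) ('X - (q ^ r *: 'X)%:P))
                 (comp2 (YW u) (YW v)))
}.

End PhiCoordinated.

(* Main.v *)
Require Import Defs.
From mathcomp Require Import all_boot all_order all_algebra complex reals.
From mathcomp Require Import finmap monalg boolp classical_sets functions fsbigop.
From mathcomp Require Import zify ring.

(** The operators E_{k,l} are the coefficients of the fields Y_W(G_{k,0}, x), and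
    equivariance gives Y_W(G_{k,m}, x) = Y_W(G_{k,0}, q^m x).  What has to be
    proved is their commutation relation; it comes from a residue computation.

    Fix w in W and u, v in the vertex algebra, and look at one total degree s.
    The coefficients of x1^m x2^(s-m) in Y_W(u, x1) Y_W(v, x2) w form a sequence A
    that vanishes for large m, and those of Y_W(v, x2) Y_W(u, x1) w a sequence B
    that vanishes for small m.  Some product of factors x - q^r (x = x1/x2) turns
    both into Laurent polynomials.  These coincide ([quasi_commute]), so A and B are
    the expansions at infinity and at 0 of one rational function, whose poles are
    among the q^r, and A - B is determined by the principal parts at the poles
    ([residue_formula]): subtracting them leaves a rational function with no pole,
    for which both expansions agree ([eq_of_no_pole]).

    The Laurent expansion of this function at x = e^z is Y_W(Y(u, z) v, x2) w in
    degree s.  The axiom of a quasi module says so only after multiplication by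
    f(x2 e^z, x2) for some nonzero f; such a factor can be cancelled and replaced by
    the product of the x1 - q^r x2 ([associativity_transfer]).  The expansion at
    x = q^r e^z is obtained by replacing u by tau_r u ([product_at_qpower]).  The
    equality of the two Laurent polynomials is tested on their expansions at
    x = e^z, where it is the skew-symmetry Y(u, z) v = e^{zD} Y(v, -z) u combined
    with Y_W(e^{zD} u, x) = Y_W(u, x e^z) ([iterate_coef_skew]).

    This yields [commutator]: the commutator is the sum over r of
    q^{-rm} (Y_W((tau_r u)_0 v) - m Y_W((tau_r u)_1 v)) when (tau_r u)_n v = 0 for
    n >= 2.  For u = G_{a,0} and v = G_{b,0} only r = a+b, -(a+b) and 0 contribute,
    and the three terms are the two structure constants and the central term of the
    algebra of q-difference operators ([mode_commutator]). *)

Set Implicit Arguments.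
Unset Strict Implicit.
Unset Printing Implicit Defensive.

Import Order.TTheory GRing.Theory Num.Theory.
Local Open Scope ring_scope.

Lemma foldr_perm (X : eqType) (Z : Type) (P : Z -> Prop) (op : X -> Z -> Z)
    (z : Z) (s t : seq X) :
  (forall x y c, P c -> op x (op y c) = op y (op x c)) ->
  (forall x c, P c -> P (op x c)) -> P z -> perm_eq s t ->
  foldr op z s = foldr op z t.
Proof.
move=> opC opP Pz.
have foldP r : P (foldr op z r) by elim: r => //= x r; apply: opP.
elim: s t => [|x s IH] t st; first by move: st; rewrite perm_sym => /perm_nilP->.
have xt : x \in t by rewrite -(perm_mem st) mem_head.
have st' : perm_eq s (rem x t) by rewrite -(perm_cons x) (perm_trans st) ?perm_to_rem.
rewrite /= (IH _ st') {IH st st'}.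
elim: t xt => //= y t IH; rewrite inE; have [->//|xy /= xt] := eqVneq x y.
by rewrite opC ?IH.
Qed.

Lemma subrACA_sub (V : zmodType) (a b c d : V) : (a - b) - (c - d) = (a - c) - (b - d).
Proof. by rewrite !opprD addrACA. Qed.

(** * Sums over the integers and the coefficients of e^{sz} *)

Section Sums.
Context {F : numFieldType} {M : lmodType F}.
Implicit Types (h : int -> M) (s t k : int).

Lemma fsbig_uniq (T : choiceType) (r : seq T) (h : T -> M) :
  uniq r -> (forall i, i \notin r -> h i = 0) ->
  \sum_(i \in [set: T]) h i = \sum_(i <- r) h i.
Proof.
move=> ur hr; rewrite (fsbigTE [fset x in r]%fset) => [|i]; last first.
  by rewrite inE /=; exact: hr.
by apply: perm_big; rewrite uniq_perm // => i; rewrite inE.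
Qed.

Definition fsum h : M := \sum_(i \in [set: int]) h i.

Lemma fsumE (r : seq int) h :
  uniq r -> (forall i, i \notin r -> h i = 0) -> fsum h = \sum_(i <- r) h i.
Proof. exact: fsbig_uniq. Qed.

Definition fsupp h := exists r : seq int, forall i, i \notin r -> h i = 0.

Lemma fsuppE h : fsupp h ->
  exists2 r : seq int, uniq r & forall i, i \notin r -> h i = 0.
Proof.
by move=> [r hr]; exists (undup r); rewrite ?undup_uniq // => i; rewrite mem_undup;
  apply: hr.
Qed.

Definition irange (a : int) (n : nat) : seq int := [seq a + i%:Z | i <- iota 0 n].

Lemma irange_uniq a n : uniq (irange a n).
Proof. by rewrite map_inj_uniq ?iota_uniq // => i j /addrI []. Qed.

Lemma mem_irange a n i : (i \in irange a n) = (a <= i) && (i < a + n%:Z).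
Proof.
apply/mapP/idP => [[j]|/andP[ai ib]].
  by rewrite mem_iota => /andP[_ jn] ->; lia.
by exists `|i - a|%N; rewrite ?mem_iota; lia.
Qed.

Lemma fsupp_bounds h (a b : int) :
  (forall i, i < a -> h i = 0) -> (forall i, b < i -> h i = 0) -> fsupp h.
Proof.
move=> ha hb; exists (irange a `|b - a + 1|) => i; rewrite mem_irange => ir.
by case: (ltP i a) => [/ha//|ai]; apply: hb; lia.
Qed.

Lemma fsumD h g : fsupp h -> fsupp g ->
  fsum (fun i => h i + g i) = fsum h + fsum g.
Proof.
move=> [r hr] [r' gr]; pose rr := undup (r ++ r').
have ru : uniq rr by rewrite undup_uniq.
have off i : i \notin rr -> h i = 0 /\ g i = 0.
  by rewrite mem_undup mem_cat negb_or => /andP[/hr-> /gr->].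
rewrite (fsumE ru) ?(fsumE (h := h) ru) ?(fsumE (h := g) ru) ?big_split //.
- by move=> i /off[].
- by move=> i /off[].
- by move=> i /off[-> ->]; rewrite addr0.
Qed.

Lemma fsumZ c h : fsupp h -> fsum (fun i => c *: h i) = c *: fsum h.
Proof.
move=> /fsuppE[r ru hr]; rewrite !(fsumE ru) ?scaler_sumr //.
by move=> i /hr->; rewrite scaler0.
Qed.

Lemma eq_fsum h g : h =1 g -> fsum h = fsum g.
Proof. by move=> /funext->. Qed.

Lemma fsum_shift s h : fsupp h -> fsum (fun i => h (i - s)) = fsum h.
Proof.
move=> /fsuppE[r ru hr]; rewrite (fsumE (h := h) ru) //.
rewrite (fsumE (r := [seq i + s | i <- r])).
- by rewrite big_map; apply: eq_bigr => i _ /=; rewrite addrK.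
- by rewrite map_inj_uniq //; apply: addIr.
- move=> i; rewrite -[X in X \notin _](subrK s) (mem_map (f := fun i => i + s)).
    exact: hr.
  exact: addIr.
Qed.

Lemma fsum_opp s h : fsupp h -> fsum (fun i => h (s - i)) = fsum h.
Proof.
move=> /fsuppE[r ru hr]; rewrite (fsumE (h := h) ru) //.
have inj : injective (fun i => s - i) by move=> i j /addrI /oppr_inj.
rewrite (fsumE (r := [seq s - i | i <- r])).
- by rewrite big_map; apply: eq_bigr => i _ /=; rewrite subKr.
- by rewrite map_inj_uniq.
- move=> i; rewrite -[X in X \notin _](subKr s).
  by rewrite (mem_map inj) => /hr.
Qed.

(** Extending [expz] by 0 to negative k lets convolutions with e^{sz} be sums over
    all of Z. *)
Definition exp_coef s k : F := if k is Posz a then expz s a else 0.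

Lemma exp_coef_lt0 s k : k < 0 -> exp_coef s k = 0.
Proof. by case: k. Qed.

Lemma exp_coef0 s : exp_coef s 0 = 1.
Proof. by rewrite -[LHS]/(expz s 0) /expz expr0 fact0 divr1. Qed.

Lemma exp_coef1 s : exp_coef s 1 = s%:~R.
Proof. by rewrite -[LHS]/(expz s 1) /expz expr1 factS fact0 divr1. Qed.

Lemma exp_coefN_nat s (a : nat) : exp_coef (- s) a = (-1) ^+ a * exp_coef s a.
Proof. by rewrite /exp_coef /expz mulrNz (exprNn s%:~R) mulrA. Qed.

Lemma factF_neq0 a : (a`!)%:R != 0 :> F.
Proof. by rewrite pnatr_eq0 -lt0n fact_gt0. Qed.

Lemma expzD s t c : expz (s + t) c = \sum_(a < c.+1) expz s (c - a) * expz t a :> F.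
Proof.
rewrite /expz rmorphD exprDn mulr_suml; apply: eq_bigr => -[a /= ac] _.
have -> : (c`!)%:R = ('C(c, a))%:R * ((a`!)%:R * ((c - a)`!)%:R) :> F.
  by rewrite -!natrM bin_fact.
have C0 : ('C(c, a))%:R != 0 :> F by rewrite pnatr_eq0 -lt0n bin_gt0.
rewrite -mulr_natr; field.
by rewrite C0 !factF_neq0.
Qed.

(** The identity e^{sz} e^{tz} = e^{(s+t)z} in the shifted form in which it makes
    multiplications by exponentials compose. *)
Lemma exp_coefD s t k j (r : seq int) : uniq r ->
  (forall i, j <= i <= k -> i \in r) ->
  exp_coef (s + t) (k - j) = \sum_(i <- r) exp_coef s (k - i) * exp_coef t (i - j).
Proof.
move=> ru rP; case: (ltP k j) => [kj|jk].
  rewrite exp_coef_lt0 ?subr_lt0 // big1 // => i _.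
  case: (ltP k i) => ik; first by rewrite exp_coef_lt0 ?mul0r ?subr_lt0.
  by rewrite [X in _ * X]exp_coef_lt0 ?mulr0 //; lia.
pose c := `|k - j|%N; pose F1 i := exp_coef s (k - i) * exp_coef t (i - j).
have kE : k = j + c by rewrite /c; lia.
have sub : {subset irange j c.+1 <= r}.
  by move=> i; rewrite mem_irange => ?; apply: rP; lia.
have -> : \sum_(i <- r) F1 i = \sum_(i <- irange j c.+1) F1 i.
  rewrite (bigID (fun i => i \in irange j c.+1)) /= [X in _ + X]big1 ?addr0.
    rewrite -big_filter; apply: perm_big; apply: uniq_perm.
    - exact: filter_uniq.
    - exact: irange_uniq.
    - by move=> i; rewrite mem_filter andb_idr //; apply: sub.
  move=> i; rewrite mem_irange => ij; rewrite /F1.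
  case: (ltP i j) => ?; first by rewrite [X in _ * X]exp_coef_lt0 ?mulr0 //; lia.
  by rewrite exp_coef_lt0 ?mul0r //; lia.
rewrite big_map -/(index_iota 0 c.+1).
have -> : k - j = c :> int by rewrite /c; lia.
rewrite [LHS]expzD (big_mkord xpredT) /=; apply: eq_bigr => -[a /= ac] _; rewrite /F1.
have -> : k - (j + a) = (c - a)%N :> int by lia.
by have -> : j + a - j = a :> int by lia.
Qed.

End Sums.

(** * Laurent series in z and the substitution x = e^z *)

Section Laurent.
Context {F : numFieldType} {M : lmodType F}.
Implicit Types (h g c : int -> M) (s t k K : int).

Lemma big_iota n (f : nat -> M) : \sum_(a <- iota 0 n) f a = \sum_(a < n) f a.
Proof. by rewrite -(big_mkord xpredT f) /index_iota subn0. Qed.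

(** A sequence h with this property stands for the Laurent series
    sum_k (h k) z^k, whose terms of degree less than K are zero. *)
Definition vanish_below K h := forall k, k < K -> h k = 0.

(** Multiplication of a Laurent series in z by e^{sz}. *)
Definition expmul s h k : M := fsum (fun j => exp_coef s (k - j) *: h j).

Lemma eq_expmul s h g : h =1 g -> expmul s h =1 expmul s g.
Proof. by move=> /funext->. Qed.

Lemma expmulE K s h k (r : seq int) : vanish_below K h -> uniq r ->
  (forall i, K <= i <= k -> i \in r) ->
  expmul s h k = \sum_(j <- r) exp_coef s (k - j) *: h j.
Proof.
move=> hK ru rP; apply: fsumE => // i ir; case: (ltP i K) => [/hK->|Ki].
  by rewrite scaler0.
rewrite exp_coef_lt0 ?scale0r // subr_lt0 ltNge; apply: contra ir => ik.
by apply: rP; rewrite Ki.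
Qed.

Lemma expmulE_range K s h k : vanish_below K h ->
  expmul s h k = \sum_(j <- irange K `|k - K|.+1) exp_coef s (k - j) *: h j.
Proof.
move=> hK; apply: (expmulE s hK); first exact: irange_uniq.
by move=> i; rewrite mem_irange; lia.
Qed.

Lemma expmul_vanish K s h : vanish_below K h -> vanish_below K (expmul s h).
Proof.
move=> hK k kK; rewrite (expmulE (r := [::]) s hK) ?big_nil //.
by move=> i /andP[/le_trans/[apply]]; rewrite leNgt kK.
Qed.

Lemma expmul_ord K s h k (n : nat) : vanish_below K h -> k < K + n%:Z ->
  expmul s h k = \sum_(a < n) expz s a *: h (k - a%:Z).
Proof.
move=> hK kn; rewrite (expmulE (r := [seq k - a%:Z | a <- iota 0 n]) s hK).
- rewrite big_map big_iota; apply: eq_bigr => a _.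
  by rewrite subKr.
- by rewrite map_inj_uniq ?iota_uniq // => i j /addrI/oppr_inj[].
- move=> i /andP[Ki ik]; apply/mapP; exists `|k - i|%N; last by lia.
  by rewrite mem_iota; lia.
Qed.

Lemma expmul_fsbig K s h k : vanish_below K h ->
  expmul s h k = \sum_(a \in [set: nat]) expz s a *: h (k - a%:Z).
Proof.
move=> hK; pose n := `|k - K|.+1.
have kn : k < K + n%:Z by lia.
rewrite (expmul_ord s hK kn) (fsbig_uniq (iota_uniq 0 n)) => [|a].
  by rewrite big_iota.
by rewrite mem_iota => an; rewrite hK ?scaler0 //; lia.
Qed.

Lemma expmulD K s t h : vanish_below K h -> expmul s (expmul t h) =1 expmul (s + t) h.
Proof.
move=> hK k; have hK' := expmul_vanish t hK.
rewrite (expmulE_range s k hK') (expmulE_range (s + t) k hK); set r := irange _ _.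
have ru : uniq r by apply: irange_uniq.
under eq_big_seq => i ir.
  rewrite (expmulE (r := r) t hK) //; last first.
    by move: ir => + x; rewrite !mem_irange; lia.
  rewrite scaler_sumr; under eq_bigr do rewrite scalerA.
  over.
rewrite exchange_big /= ; apply: eq_big_seq => j jr.
rewrite -scaler_suml (exp_coefD s t (k := k) (j := j) ru) // => i.
by move: jr; rewrite !mem_irange; lia.
Qed.

Lemma vanish_belowW K K' h : K' <= K -> vanish_below K h -> vanish_below K' h.
Proof. by move=> KK hK k /lt_le_trans/(_ KK)/hK. Qed.

Lemma expmul_linear K s a h b g : vanish_below K h -> vanish_below K g ->
  expmul s (fun k => a *: h k + b *: g k) =1
    (fun k => a *: expmul s h k + b *: expmul s g k).
Proof.
move=> hK gK k; rewrite (expmulE_range (K := K)) => [|j /[dup]/hK-> /gK->]; last first.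
  by rewrite !scaler0 addr0.
rewrite (expmulE_range s k hK) (expmulE_range s k gK) !scaler_sumr -big_split /=.
by apply: eq_bigr => j _; rewrite scalerDr !scalerA ![_ * exp_coef _ _]mulrC.
Qed.

Lemma expmul_lead k s h : vanish_below k h -> expmul s h k = h k.
Proof.
move=> hk; rewrite (expmul_ord (n := 1) s hk) ?ltrDl // big_ord1 subr0.
by rewrite -[expz s _]/(exp_coef s 0) exp_coef0 scale1r.
Qed.

Lemma expmul_lead1 k s h : vanish_below k h -> expmul s h (k + 1) =
  h (k + 1) + s%:~R *: h k.
Proof.
move=> hk; rewrite (expmul_ord (n := 2) s hk) ?ltrD2l // !big_ord_recl big_ord0 /=
  subr0.
rewrite -[expz s 0]/(exp_coef s 0) -[expz s (bump 0 0)]/(exp_coef s 1) exp_coef0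
  exp_coef1 scale1r addr0.
by rewrite addrK.
Qed.

(** The substitution of -z for z. *)
Definition reflect_z h k : M := ((-1 : F) ^ k) *: h k.

Lemma reflect_z_vanish K h : vanish_below K h -> vanish_below K (reflect_z h).
Proof. by move=> hK k /hK; rewrite /reflect_z => ->; rewrite scaler0. Qed.

Lemma N1_neq0 : (-1 : F) != 0. Proof. by rewrite oppr_eq0 oner_eq0. Qed.

Lemma exp_coefN s k : exp_coef (- s) k = (-1) ^ k * exp_coef s k :> F.
Proof. by case: k => a; [exact: exp_coefN_nat | rewrite /= mulr0]. Qed.

Lemma reflect_z_expmul K s h : vanish_below K h -> reflect_z (expmul s h) =1
  expmul (- s) (reflect_z h).
Proof.
move=> hK k; rewrite /reflect_z (expmulE_range s k hK)
  (expmulE_range _ k (reflect_z_vanish hK)).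
rewrite scaler_sumr; apply: eq_bigr => j _.
by rewrite /reflect_z !scalerA exp_coefN mulrAC -(expfzDr _ _ N1_neq0) subrK.
Qed.

Lemma reflect_z_linear a h b g : reflect_z (fun k => a *: h k + b *: g k)
  =1 (fun k => a *: reflect_z h k + b *: reflect_z g k).
Proof. by move=> k; rewrite /reflect_z scalerDr !scalerA ![(-1) ^ k * _]mulrC. Qed.

(** The expansion at x = e^z of the Laurent polynomial sum_m (c m) x^m. *)
Definition at_exp c k : M := fsum (fun m => exp_coef m k *: c m).

Lemma eq_at_exp c d : c =1 d -> at_exp c =1 at_exp d.
Proof. by move=> /funext->. Qed.

Lemma at_expE c k (r : seq int) : uniq r -> (forall i, i \notin r -> c i = 0) ->
  at_exp c k = \sum_(m <- r) exp_coef m k *: c m.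
Proof. by move=> ru rc; apply: fsumE => // i /rc->; rewrite scaler0. Qed.

Lemma at_exp_vanish c : vanish_below 0 (at_exp c).
Proof.
move=> k k0; rewrite /at_exp (_ : (fun m => _) = (fun=> 0)); last first.
  by apply: funext => m; rewrite exp_coef_lt0 // scale0r.
by rewrite (fsumE (r := [::])) // big_nil.
Qed.

Lemma fsuppZ (a : int -> F) c : fsupp c -> fsupp (fun m => a m *: c m).
Proof. by move=> [r rc]; exists r => i /rc->; rewrite scaler0. Qed.

Lemma fsuppDZ a c b d : fsupp c -> fsupp d -> fsupp (fun m => a *: c m + b *: d m).
Proof.
move=> [r rc] [r' rd]; exists (r ++ r') => i; rewrite mem_cat negb_or.
by move=> /andP[/rc-> /rd->]; rewrite !scaler0 addr0.
Qed.

Lemma fsupp_shift s c : fsupp c -> fsupp (fun m => c (m - s)).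
Proof.
move=> [r rc]; exists [seq i + s | i <- r] => i ir; apply: rc; apply: contra ir => ir.
by apply/mapP; exists (i - s) => //; rewrite subrK.
Qed.

Lemma fsupp_rev s c : fsupp c -> fsupp (fun m => c (s - m)).
Proof.
move=> [r rc]; exists [seq s - i | i <- r] => i ir; apply: rc; apply: contra ir => ir.
by apply/mapP; exists (s - i) => //; rewrite subKr.
Qed.

Lemma at_exp_linear a c b d : fsupp c -> fsupp d ->
  at_exp (fun m => a *: c m + b *: d m) =1 (fun k => a *: at_exp c k + b *: at_exp d k).
Proof.
move=> cf df k; rewrite /at_exp -!fsumZ -?fsumD; try exact: fsuppZ.
- by apply: eq_fsum => m; rewrite scalerDr !scalerA ![exp_coef _ _ * _]mulrC.
- by apply: fsuppZ; apply: fsuppZ.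
- by apply: fsuppZ; apply: fsuppZ.
Qed.

(** Multiplication by x^s becomes multiplication by e^{sz}. *)
Lemma at_exp_shift s c : fsupp c -> at_exp (fun m => c (m - s)) =1 expmul s (at_exp c).
Proof.
move=> cf k; have /fsuppE[r ru rc] := cf.
rewrite (expmulE_range s k (@at_exp_vanish c)); set r' := irange _ _.
have ru' : uniq r' by apply: irange_uniq.
have -> : at_exp (fun m => c (m - s)) k = fsum (fun m => exp_coef (s + m) k *: c m).
  rewrite -(@fsum_shift _ _ s); last exact: fsuppZ.
  by apply: eq_fsum => m /=; rewrite [s + _]addrC subrK.
rewrite (fsumE ru) => [|i /rc->]; last by rewrite scaler0.
under eq_bigr => m _.
  rewrite -[X in exp_coef _ X]subr0 (exp_coefD s m ru') => [|i]; last first.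
    by rewrite mem_irange; lia.
  rewrite scaler_suml; over.
rewrite exchange_big; apply: eq_bigr => j _ /=.
rewrite (at_expE _ ru rc) scaler_sumr; apply: eq_bigr => i _.
by rewrite scalerA subr0.
Qed.

Lemma fsupp_opp c : fsupp c -> fsupp (fun m => c (- m)).
Proof.
by move=> /(fsupp_rev 0); under [X in fsupp X -> _]eq_fun do rewrite sub0r.
Qed.

Lemma at_exp_opp c : fsupp c -> at_exp (fun m => c (- m)) =1 reflect_z (at_exp c).
Proof.
move=> cf k; rewrite /reflect_z /at_exp -fsumZ; last exact: fsuppZ.
rewrite -(@fsum_opp _ _ 0); last exact: fsuppZ (fsupp_opp cf).
by apply: eq_fsum => m; rewrite sub0r opprK exp_coefN scalerA.
Qed.

Lemma at_exp_rev s c : fsupp c -> at_exp (fun m => c (s - m)) =1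
  expmul s (reflect_z (at_exp c)).
Proof.
move=> cf k; rewrite -(eq_expmul s (at_exp_opp cf)) -(at_exp_shift s (fsupp_opp cf)).
by apply: eq_at_exp => m; rewrite opprB.
Qed.

Lemma at_exp_horner c (r : seq int) (g : {poly F}) : uniq r ->
  (forall i, i \notin r -> c i = 0) -> (forall k, at_exp c k = 0) ->
  \sum_(m <- r) g.[m%:~R] *: c m = 0.
Proof.
move=> ru rc c0; under eq_bigr => m _ do rewrite horner_coef scaler_suml.
rewrite exchange_big big1 //= => a _.
transitivity ((g`_a * (a`!)%:R) *: at_exp c a); last by rewrite c0 scaler0.
rewrite (at_expE _ ru rc) scaler_sumr; apply: eq_bigr => m _.
by rewrite scalerA /exp_coef /expz mulrACA mulrV ?mulr1 ?unitfE ?factF_neq0 // mulrA.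
Qed.

(** The coefficients of the expansion are, up to factorials, the power sums
    sum_m m^k c_m.  They combine to sum_m g(m) c_m for every polynomial g, and taking
    for g a product that kills all but one point of the support isolates one c_m. *)
Lemma at_exp_inj c : fsupp c -> (forall k, at_exp c k = 0) -> forall m, c m = 0.
Proof.
move=> /fsuppE[r ru rc] c0 m; have [mr|/rc//] := boolP (m \in r).
pose g : {poly F} := \prod_(i <- r | i != m) ('X - (i%:~R)%:P).
have := at_exp_horner g ru rc c0; rewrite (bigD1_seq m) //= big_seq_cond big1 => [|i].
  rewrite addr0 => /eqP; rewrite scaler_eq0 horner_prod => /orP[|/eqP//].
  rewrite prodf_seq_eq0 => /hasP[i ir]; rewrite hornerXsubC subr_eq0 eqr_int => /andP[].
  by rewrite eq_sym => /negPf->.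
move=> /andP[ir im]; rewrite horner_prod [X in X *: _](_ : _ = 0) ?scale0r //.
apply/eqP; rewrite prodf_seq_eq0; apply/hasP; exists i => //.
by rewrite im hornerXsubC subrr eqxx.
Qed.

End Laurent.

(** * Polynomials acting on series *)

Section PolyAction.
Context {F : numFieldType} {W : lmodType F}.
Implicit Types (c p : {poly F}) (g : int -> W).

Definition poly_act c g (s : int) : W := \sum_(j < size c) c`_j *: g (s - j%:Z).

Lemma poly_act_bound n c g s : (size c <= n)%N ->
  poly_act c g s = \sum_(j < n) c`_j *: g (s - j%:Z).
Proof.
move=> cn; rewrite /poly_act (big_ord_widen n (fun j => c`_j *: g (s - j%:Z)) cn).
rewrite big_mkcond; apply: eq_bigr => j _; case: ltnP => // /leq_sizeP->//.
by rewrite scale0r.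
Qed.

Lemma poly_act_sum (I : finType) (a : I -> F) (c : I -> {poly F}) g s :
  poly_act (\sum_i a i *: c i) g s = \sum_i a i *: poly_act (c i) g s.
Proof.
pose n := maxn (size (\sum_i a i *: c i)) (\max_i size (c i)).
rewrite (@poly_act_bound n) ?leq_maxl //.
under [RHS]eq_bigr => i _.
  rewrite (@poly_act_bound n); last by rewrite leq_max orbC (leq_bigmax i).
  rewrite scaler_sumr; over.
rewrite exchange_big; apply: eq_bigr => j _ /=.
by rewrite coef_sum scaler_suml; apply: eq_bigr => i _; rewrite coefZ scalerA.
Qed.

Lemma poly_actMXn c i g s : poly_act (c * 'X^i) g s = poly_act c g (s - i%:Z).
Proof.
rewrite (@poly_act_bound (i + size c)%N); last first.
  by rewrite (leq_trans (size_polyMleq _ _)) // size_polyXn addnS addnC.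
rewrite big_split_ord /= big1 ?add0r => [|j _]; last by rewrite coefMXn ltn_ord scale0r.
apply: eq_bigr => j _; rewrite coefMXn ltnNge leq_addr /= addKn.
by rewrite PoszD opprD addrA.
Qed.

(** The lowest term of the product is the product of the lowest terms. *)
Lemma poly_act_inj c g : c != 0 -> (exists N : int, forall s, s < N -> g s = 0) ->
  (forall s, poly_act c g s = 0) -> forall s, g s = 0.
Proof.
move=> c0 [N gN] cg.
have cex : exists j, c`_j != 0 by exists (size c).-1; rewrite -lead_coefE lead_coef_eq0.
have [j0 cj0 jmin] := ex_minnP cex.
have j0c : (j0 < size c)%N by rewrite ltnNge; apply: contra cj0 => /leq_sizeP->.
suff gn (n : nat) s : s < N + n%:Z -> g s = 0.
  by move=> s; apply: (gn `|s - N|.+1); lia.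
elim: n s => [|n IH] s sn; first by apply: gN; rewrite addr0 in sn.
have := cg (s + j0); rewrite /poly_act (bigD1 (Ordinal j0c)) //= addrK big1 ?addr0.
  by move=> /eqP; rewrite scaler_eq0 (negPf cj0) => /eqP.
move=> -[j /= jc] /eqP jj0; have {}jj0 : j != j0.
  by apply/eqP => jE; apply: jj0; apply: val_inj.
case: (ltnP j j0) => [jlt|jge].
  have [->|/jmin] := eqVneq c`_j 0; first by rewrite scale0r.
  by rewrite leqNgt jlt.
by rewrite IH ?scaler0 //; lia.
Qed.

End PolyAction.

(** * Associativity with an arbitrary multiplier *)

Section TwoVariables.
Context {F : numFieldType} {W : lmodType F}.
Implicit Types (f : {poly {poly F}}) (A B H : int -> int -> W) (m n k s K N : int).

Lemma fsum_sum (I : Type) (r : seq I) (a : I -> F) (c : I -> int -> W) :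
  (forall i, fsupp (c i)) ->
  fsupp (fun m => \sum_(i <- r) a i *: c i m) /\
  fsum (fun m => \sum_(i <- r) a i *: c i m) = \sum_(i <- r) a i *: fsum (c i).
Proof.
move=> cf; elim: r => [|i r [IHf IH]].
  split; first by exists [::] => m _; rewrite big_nil.
  rewrite big_nil (_ : (fun m => _) = (fun=> 0)) ?(fsumE (r := [::])) ?big_nil //.
  by apply: funext => m; rewrite big_nil.
have E : (fun m => \sum_(j <- i :: r) a j *: c j m) =
         (fun m => a i *: c i m + \sum_(j <- r) a j *: c j m).
  by apply: funext => m; rewrite big_cons.
have cfi : fsupp (fun m => a i *: c i m) by apply: (fsuppZ (fun=> a i)).
split; first by rewrite E; have := fsuppDZ 1 1 cfi IHf;
  under eq_fun do rewrite !scale1r.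
by rewrite E fsumD // big_cons IH fsumZ.
Qed.

Lemma at_exp_sum (I : Type) (r : seq I) (a : I -> F) (c : I -> int -> W) k :
  (forall i, fsupp (c i)) ->
  at_exp (fun m => \sum_(i <- r) a i *: c i m) k = \sum_(i <- r) a i *: at_exp (c i) k.
Proof.
move=> cf; rewrite /at_exp -(fsum_sum _ _ _).2 => [|i]; last exact: fsuppZ.
by apply: eq_fsum => m; rewrite scaler_sumr; apply: eq_bigr => i _;
  rewrite !scalerA mulrC.
Qed.

Lemma expmul_fsupp K t (h : int -> W) k : vanish_below K h ->
  fsupp (fun j => exp_coef t (k - j) *: h j).
Proof.
move=> hK; apply: (fsupp_bounds (a := K) (b := k)) => i ik.
  by rewrite hK ?scaler0.
by rewrite exp_coef_lt0 ?scale0r // subr_lt0.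
Qed.

Lemma expmul_sum (I : Type) (r : seq I) (a : I -> F) (h : I -> int -> W) K t k :
  (forall i, vanish_below K (h i)) ->
  expmul t (fun j => \sum_(i <- r) a i *: h i j) k = \sum_(i <- r) a i *: expmul t (h i) k.
Proof.
move=> hK; rewrite /expmul -(fsum_sum _ _ _).2 => [|i]; last exact: expmul_fsupp.
by apply: eq_fsum => m; rewrite scaler_sumr; apply: eq_bigr => i _;
  rewrite !scalerA mulrC.
Qed.

(** Both kinds of multiplication by f, on x1, x2 and on z, x2, are sums of this
    shape. *)
Definition csum f (x : nat -> nat -> W) : W :=
  \sum_(i < size f) \sum_(j < size f`_i) f`_i`_j *: x i j.

Lemma eq_csum f x y : (forall i j, x i j = y i j) -> csum f x = csum f y.
Proof. by move=> xy; apply: eq_bigr => i _; apply: eq_bigr => j _; rewrite xy. Qed.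

Lemma csumDZ f a b x y :
  csum f (fun i j => a *: x i j + b *: y i j) = a *: csum f x + b *: csum f y.
Proof.
rewrite /csum !scaler_sumr -big_split; apply: eq_bigr => i _ /=.
rewrite !scaler_sumr -big_split; apply: eq_bigr => j _ /=.
by rewrite scalerDr !scalerA ![f`_i`_j * _]mulrC.
Qed.

Lemma csumB f b x y :
  csum f (fun i j => x i j - b *: y i j) = csum f x - b *: csum f y.
Proof.
rewrite -[X in X - _]scale1r -scaleNr -csumDZ; apply: eq_csum => i j.
by rewrite scale1r scaleNr.
Qed.

Lemma csum_pair f x : csum f x =
  \sum_(p <- [seq (i, j) | i <- iota 0 (size f), j <- iota 0 (size f`_i)])
    f`_p.1`_p.2 *: x p.1 p.2.
Proof.
rewrite big_allpairs_dep
  (big_iota _ (fun i => \sum_(j <- iota 0 (size f`_i)) f`_i`_j *: x i j)).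
by apply: eq_bigr => i _; rewrite (big_iota _ (fun j => f`_i`_j *: x i j)).
Qed.

Definition poly_act2 f A m n : W := csum f (fun i j => A (m - i%:Z) (n - j%:Z)).

Definition quadrant A := exists N, forall m n, (m < N) || (n < N) -> A m n = 0.

(** The part of total degree s, as a sequence in the exponent of x1: a series in
    x = x1 / x2 once a power of x2 is taken out. *)
Definition line s A m : W := A m (s - m).

Lemma quadrant_line A s : quadrant A -> fsupp (line s A).
Proof.
move=> [N AN]; apply: (fsupp_bounds (a := N) (b := s - N)) => i iN; apply: AN; lia.
Qed.

(** The substitution A(x2 e^z, x2): in total degree s it is the expansion of the
    line at x = e^z. *)
Definition lines_at_exp A k s : W := at_exp (line s A) k.

(** The product f(x2 e^z, x2) H(z, x2). *)
Definition poly_act_exp f H k s : W :=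
  csum f (fun i j => expmul i (fun k => H k (s - i%:Z - j%:Z)) k).

Definition vanish_below2 K H := forall s, vanish_below K (fun k => H k s).

Lemma lines_at_exp_vanish A : vanish_below2 0 (lines_at_exp A).
Proof. by move=> s; apply: at_exp_vanish. Qed.

Lemma lines_at_exp_poly_act2 f A k s : quadrant A -> lines_at_exp (poly_act2 f A) k s =
  poly_act_exp f (lines_at_exp A) k s.
Proof.
move=> Aq; rewrite /lines_at_exp /poly_act_exp csum_pair.
under [LHS]eq_at_exp => m do rewrite /line /poly_act2 csum_pair.
rewrite (@at_exp_sum _ _ _ (fun p m => A (m - p.1%:Z) (s - m - p.2%:Z))) => [|[i j]].
  apply: eq_bigr => -[i j] _ /=; congr (_ *: _).
  rewrite -(at_exp_shift i (quadrant_line _ Aq)); apply: eq_at_exp => m; rewrite /line.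
  by congr A; lia.
have := fsupp_shift i (quadrant_line (s - i%:Z - j%:Z) Aq); rewrite /line /=.
congr fsupp; apply: funext => m; congr A; lia.
Qed.

(** The coefficient of z^a in f(x2 e^z, x2), a polynomial in x2. *)
Definition subst_coef f (a : nat) : {poly F} :=
  \sum_(i < size f) expz i a *: (f`_i * 'X^i).

(** The series f(x2 e^z, x2) is the expansion at x = e^z of the Laurent
    polynomial sum_i (f_i x2^i) x^i with values in F[x2], and such expansions
    determine the polynomial. *)
Lemma subst_coef_neq0 f : f != 0 -> exists a, subst_coef f a != 0.
Proof.
move=> f0; apply: contra_notP (elimN eqP f0) => /forallNP za.
pose c (i : int) : {poly F} := if i is Posz i then f`_i * 'X^i else 0.
pose r := [seq Posz i | i <- iota 0 (size f)].
have ru : uniq r by rewrite map_inj_uniq ?iota_uniq // => i j [].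
have rc i : i \notin r -> c i = 0.
  case: i => // i; rewrite mem_map => [|? ? []//]; rewrite mem_iota /= add0n -leqNgt.
  by move=> /leq_sizeP->; rewrite ?mul0r.
apply/polyP => i; rewrite coef0.
have : f`_i * 'X^i = 0.
  rewrite -[LHS]/(c i); apply: at_exp_inj => [|[a|a]];
    [by exists r| |exact: at_exp_vanish].
  rewrite (at_expE _ ru rc) big_map.
  rewrite -[RHS](eqP (negbNE (introN idP (za a)))) /subst_coef.
  by rewrite -(big_mkord xpredT (fun i => expz i a *: (f`_i * 'X^i))) /index_iota subn0.
by move=> /eqP; rewrite mulf_eq0 (negPf (monic_neq0 (monicXn _ _))) orbF => /eqP.
Qed.

Lemma poly_act_expE f H K k s (n : nat) : vanish_below2 K H -> k < K + n%:Z ->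
  poly_act_exp f H k s = \sum_(a < n) poly_act (subst_coef f a) (H (k - a%:Z)) s.
Proof.
move=> HK kn; rewrite /poly_act_exp /csum.
under [RHS]eq_bigr => a _ do rewrite poly_act_sum.
rewrite exchange_big; apply: eq_bigr => i _ /=.
under [RHS]eq_bigr => a _ do rewrite poly_actMXn /poly_act scaler_sumr.
rewrite exchange_big; apply: eq_bigr => j _ /=.
rewrite (expmul_ord i (HK _) kn) scaler_sumr; apply: eq_bigr => a _.
by rewrite !scalerA mulrC.
Qed.

(** By induction on the power of z: the first nonzero coefficient of
    f(x2 e^z, x2) is a nonzero polynomial in x2, and it multiplies the lowest term
    of H. *)
Lemma poly_act_exp_inj f H K : f != 0 -> vanish_below2 K H ->
  (forall k, exists N, forall s, s < N -> H k s = 0) ->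
  (forall k s, poly_act_exp f H k s = 0) -> forall k s, H k s = 0.
Proof.
move=> /subst_coef_neq0 zex HK Hs fH.
have [a0 za0 amin] := ex_minnP zex.
suff Hn (n : nat) k s : k < K + n%:Z -> H k s = 0.
  by move=> k s; apply: (Hn `|k - K|.+1); lia.
elim: n k s => [|n IH] k s kn; first by apply: HK; lia.
apply: (poly_act_inj za0 (Hs k)) => {}s.
have := fH (k + a0) s; pose N := (n.+1 + a0)%N.
rewrite (@poly_act_expE f H K _ _ N) //; last by rewrite /N; lia.
have aN : (a0 < N)%N by rewrite /N; lia.
rewrite (bigD1 (Ordinal aN)) //= addrK big1 ?addr0 //.
move=> -[a /= aN'] /eqP aa0; have {}aa0 : a != a0.
  by apply/eqP => aE; apply: aa0; apply: val_inj.
case: (ltnP a a0) => [alt|age].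
  have [->|/amin] := eqVneq (subst_coef f a) 0; last by rewrite leqNgt alt.
  by rewrite /poly_act size_poly0 big_ord0.
rewrite /poly_act big1 // => j _; rewrite IH ?scaler0 //; lia.
Qed.

Lemma poly_act_expB f H H' K : vanish_below2 K H -> vanish_below2 K H' -> forall k s,
  poly_act_exp f (fun k s => H k s - H' k s) k s =
  poly_act_exp f H k s - poly_act_exp f H' k s.
Proof.
move=> HK HK' k s; rewrite -[X in _ - X]scale1r -csumB; apply: eq_csum => i j.
have := expmul_linear i 1 (-1) (HK (s - i%:Z - j%:Z)) (HK' (s - i%:Z - j%:Z)) k.
rewrite scaleN1r !scale1r => <-; apply: eq_expmul => l.
by rewrite scaleN1r scale1r.
Qed.

(** Multiplication by x1 - c x2; [lin2_exp] is multiplication by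
    x2 e^z - c x2, its image under x1 = x2 e^z. *)
Definition lin2 (c : F) A m n : W := A (m - 1) n - c *: A m (n - 1).
Definition lin2_exp (c : F) H k s : W :=
  expmul 1 (fun k => H k (s - 1)) k - c *: H k (s - 1).

Lemma quadrant_lin2 c A : quadrant A -> quadrant (lin2 c A).
Proof.
move=> [N AN]; exists N => m n mn; rewrite /lin2 !AN ?scaler0 ?subr0 //; lia.
Qed.

Lemma poly_act2_lin2 f c A : poly_act2 f (lin2 c A) = lin2 c (poly_act2 f A).
Proof.
apply: funext => m; apply: funext => n; rewrite /lin2 /poly_act2 -csumB.
by apply: eq_csum => i j; rewrite ![_ - 1 - _]addrAC.
Qed.

Lemma lin2_exp_vanish c H K : vanish_below2 K H -> vanish_below2 K (lin2_exp c H).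
Proof.
move=> HK s k kK; rewrite /lin2_exp (expmul_vanish 1 (HK _)) // sub0r.
by rewrite (HK (s - 1) k kK) scaler0 oppr0.
Qed.

Lemma lines_at_exp_lin2 c A : quadrant A -> lines_at_exp (lin2 c A) =
  lin2_exp c (lines_at_exp A).
Proof.
move=> Aq; apply: funext => k; apply: funext => s; rewrite /lines_at_exp /lin2_exp.
have ql := quadrant_line (s - 1) Aq.
rewrite -(at_exp_shift 1 ql) -scaleNr -[X in X + _]scale1r -(at_exp_linear _ _ _ ql);
  last first.
  exact: fsupp_shift.
apply: eq_at_exp => m; rewrite scaleNr scale1r /line /lin2.
by congr (A _ _ - _ *: A _ _); lia.
Qed.

Lemma poly_act_exp_lin2 f c H K : vanish_below2 K H -> poly_act_exp f (lin2_exp c H) =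
  lin2_exp c (poly_act_exp f H).
Proof.
move=> HK; apply: funext => k; apply: funext => s; rewrite /lin2_exp /poly_act_exp.
pose x i j := expmul 1 (expmul i%:Z (fun k => H k (s - 1 - i%:Z - j%:Z))) k.
have -> : expmul 1 (fun k => poly_act_exp f H k (s - 1)) k = csum f x.
  rewrite csum_pair /poly_act_exp; under eq_expmul do rewrite csum_pair.
  apply: (@expmul_sum _ _ _ (fun (p : nat * nat) l =>
    expmul p.1%:Z (fun k => H k (s - 1 - p.1%:Z - p.2%:Z)) l) K) => p.
  by apply: expmul_vanish; apply: HK.
rewrite -csumB; apply: eq_csum => i j /=.
have E t : t - i%:Z - j%:Z - 1 = t - 1 - i%:Z - j%:Z by lia.
have HKs := HK (s - 1 - i%:Z - j%:Z).
have -> : x i j = expmul i (expmul 1 (fun k => H k (s - 1 - i%:Z - j%:Z))) k.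
  by rewrite /x !(expmulD _ _ HKs) addrC.
rewrite -[X in X - _]scale1r -scaleNr -(expmul_linear _ _ _ (expmul_vanish 1 HKs) HKs).
by apply: eq_expmul => l; rewrite scale1r scaleNr E.
Qed.

Definition lin2s (T : seq F) A := foldr lin2 A T.
Definition lin2s_exp (T : seq F) H := foldr lin2_exp H T.

Lemma quadrant_lin2s T A : quadrant A -> quadrant (lin2s T A).
Proof. by move=> Aq; elim: T => //= c T; apply: quadrant_lin2. Qed.

Lemma poly_act2_lin2s f T A : poly_act2 f (lin2s T A) = lin2s T (poly_act2 f A).
Proof. by elim: T => //= c T IH; rewrite poly_act2_lin2 IH. Qed.

Lemma lin2s_exp_vanish T H K : vanish_below2 K H -> vanish_below2 K (lin2s_exp T H).
Proof. by move=> HK; elim: T => //= c T; apply: lin2_exp_vanish. Qed.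

Lemma lines_at_exp_lin2s T A : quadrant A -> lines_at_exp (lin2s T A) =
  lin2s_exp T (lines_at_exp A).
Proof.
by move=> Aq; elim: T => //= c T IH; rewrite lines_at_exp_lin2 ?IH //;
  apply: quadrant_lin2s.
Qed.

Lemma poly_act_exp_lin2s f T H K : vanish_below2 K H -> poly_act_exp f (lin2s_exp T H) =
  lin2s_exp T (poly_act_exp f H).
Proof.
move=> HK; elim: T => //= c T IH; rewrite (poly_act_exp_lin2 _ _ (K := K)) ?IH //.
exact: lin2s_exp_vanish.
Qed.

(** The bound on the exponent of x2 may depend on the power of z, since H
    lies in W((x2))((z)); it is uniform on the powers below a given one. *)
Definition lower_truncated H := forall k, exists N, forall k' s, k' <= k -> s < N ->
  H k' s = 0.

Lemma lower_truncated_of_pointwise K H : vanish_below2 K H ->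
  (forall k, exists N, forall s, s < N -> H k s = 0) -> lower_truncated H.
Proof.
move=> HK Hs k; suff Hn (n : nat) : exists N, forall k' s, k' < K + n%:Z -> s < N ->
  H k' s = 0.
  have [N HN] := Hn `|k - K|.+1; exists N => k' s k'k; apply: HN; lia.
elim: n => [|n [N HN]]; first by exists 0 => k' s k'K _; apply: HK; lia.
have [N' HN'] := Hs (K + n%:Z).
exists (Num.min N N') => k' s k'n; rewrite lt_min => /andP[sN sN'].
have [->|kK] := eqVneq k' (K + n%:Z); first exact: HN'.
by apply: HN => //; lia.
Qed.

Lemma lower_truncated_lin2_exp c K H : vanish_below2 K H -> lower_truncated H ->
  lower_truncated (lin2_exp c H).
Proof.
move=> HK Hl k; have [N HN] := Hl k; exists N => k' s k'k sN.
rewrite /lin2_exp (HN k') //; last by lia.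
rewrite scaler0 subr0 (expmul_ord (n := `|k' - K|.+1) 1 (HK _)); last by lia.
by rewrite big1 // => a _; rewrite HN ?scaler0 //; lia.
Qed.

Lemma lower_truncated_lin2s_exp T K H : vanish_below2 K H -> lower_truncated H ->
  lower_truncated (lin2s_exp T H).
Proof.
by move=> HK Hl; elim: T => //= c T; apply: lower_truncated_lin2_exp;
  apply: lin2s_exp_vanish HK.
Qed.

(** Both sides agree after a further multiplication by f(x2 e^z, x2), which
    commutes with the linear factors and is injective.  The axiom of a quasi module
    only provides some f; the factors x1 - c x2 have known zeros. *)
Lemma associativity_transfer f T A H K : f != 0 -> quadrant (lin2s T A) ->
  quadrant (poly_act2 f A) ->
  vanish_below2 K H -> (forall k, exists N, forall s, s < N -> H k s = 0) ->
  (forall k s, lines_at_exp (poly_act2 f A) k s = poly_act_exp f H k s) ->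
  forall k s, lines_at_exp (lin2s T A) k s = lin2s_exp T H k s.
Proof.
move=> f0 qT qf HK Hs fH k s; apply/eqP; rewrite -subr_eq0; apply/eqP; move: k s.
pose K' := Num.min 0 K.
have le0 : K' <= 0 by rewrite ge_min lexx.
have leK : K' <= K by rewrite ge_min lexx orbT.
have zbS : vanish_below2 K' (lines_at_exp (lin2s T A)) by move=> s;
  apply: vanish_belowW le0 _; apply: lines_at_exp_vanish.
have zbL : vanish_below2 K' (lin2s_exp T H) by move=> s; apply: (vanish_belowW leK);
  apply: lin2s_exp_vanish.
have lowL := lower_truncated_lin2s_exp T HK (lower_truncated_of_pointwise HK Hs).
apply: (poly_act_exp_inj (K := K') f0).
- by move=> s k kK /=; rewrite (zbS s k kK) (zbL s k kK) subr0.
- move=> k; have [N HN] := lowL k; have [M qM] := qT.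
  exists (Num.min N (M + M)) => s; rewrite lt_min => /andP[sN sM].
  rewrite (HN k) // subr0 /lines_at_exp (_ : line s _ = fun=> 0).
    by rewrite (@at_expE _ _ _ _ [::]) // big_nil.
  by apply: funext => m; rewrite /line qM //; lia.
move=> k s; rewrite (poly_act_expB _ zbS zbL) (poly_act_exp_lin2s _ _ HK)
  -(lines_at_exp_poly_act2 _ _ _ qT) poly_act2_lin2s.
rewrite (lines_at_exp_lin2s _ qf)
  (_ : lines_at_exp (poly_act2 f A) = poly_act_exp f H) ?subrr //.
by apply: funext => k'; apply: funext => s'; apply: fH.
Qed.

End TwoVariables.

(** * Linear factors in one variable and orders of vanishing *)

Section OneVariable.
Context {F : numFieldType} {W : lmodType F}.
Implicit Types (A B c h : int -> W) (T : seq F) (x y : F) (m k s K : int).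

(** Multiplication by X - y; [lin_exp x y] is multiplication by x e^z - y, its
    expansion at X = x e^z. *)
Definition lin1 y c m : W := c (m - 1) - y *: c m.
Definition lin_exp x y h k : W := x *: expmul 1 h k - y *: h k.
Definition lin1s T c := foldr lin1 c T.
Definition lins_exp x T h := foldr (lin_exp x) h T.

Lemma lin1D y a c b d :
  lin1 y (fun m => a *: c m + b *: d m) = (fun m => a *: lin1 y c m + b *: lin1 y d m).
Proof.
apply: funext => m; rewrite /lin1 scalerDr !scalerBr opprD addrACA !scalerA.
by rewrite ![y * _]mulrC.
Qed.

Lemma lin1sD T a c b d :
  lin1s T (fun m => a *: c m + b *: d m) =
  (fun m => a *: lin1s T c m + b *: lin1s T d m).
Proof. by elim: T => //= y T ->; rewrite lin1D. Qed.

Lemma lin1s0 T : lin1s T (fun=> 0) = fun=> 0.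
Proof.
by elim: T => //= y T ->; apply: funext => m; rewrite /lin1 scaler0 subr0.
Qed.

Lemma lin1sB T c d :
  lin1s T (fun m => c m - d m) = (fun m => lin1s T c m - lin1s T d m).
Proof.
have := lin1sD T 1 c (-1) d; under eq_fun do rewrite scale1r scaleN1r.
by move=> ->; apply: funext => m; rewrite scale1r scaleN1r.
Qed.

Lemma lin1s_sum (I : Type) (r : seq I) T (c : I -> int -> W) :
  lin1s T (fun m => \sum_(i <- r) c i m) = (fun m => \sum_(i <- r) lin1s T (c i) m).
Proof.
elim: r => [|i r IH].
  transitivity (lin1s T (fun=> 0)); first by congr lin1s; apply: funext => m;
    rewrite big_nil.
  by rewrite lin1s0; apply: funext => m; rewrite big_nil.
transitivity (lin1s T (fun m => 1 *: c i m + 1 *: \sum_(i <- r) c i m)).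
  by congr lin1s; apply: funext => m; rewrite big_cons !scale1r.
by rewrite lin1sD IH; apply: funext => m; rewrite big_cons !scale1r.
Qed.

Lemma lin1C x y c : lin1 x (lin1 y c) = lin1 y (lin1 x c).
Proof.
apply: funext => m; by rewrite /lin1 !scalerBr subrACA_sub !scalerA mulrC.
Qed.

Lemma lin1s_perm T T' c : perm_eq T T' -> lin1s T c = lin1s T' c.
Proof.
by apply: (foldr_perm (P := fun=> True)) => // x y z _; apply: lin1C.
Qed.

Lemma fsupp_lin1 y c : fsupp c -> fsupp (lin1 y c).
Proof.
move=> cf; have := fsuppDZ 1 (- y) (fsupp_shift 1 cf) cf; congr fsupp.
by apply: funext => m; rewrite /lin1 scale1r scaleNr.
Qed.

Lemma fsupp_lin1s T c : fsupp c -> fsupp (lin1s T c).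
Proof. by move=> cf; elim: T => //= y T; apply: fsupp_lin1. Qed.

(** The substitution of x X for X. *)
Definition rescale x c m : W := x ^ m *: c m.
(** The expansion at X = x e^z. *)
Definition at_pt_exp x c := at_exp (rescale x c).

Lemma fsupp_rescale x c : fsupp c -> fsupp (rescale x c).
Proof. exact: fsuppZ. Qed.

Lemma rescale_lin1 x y c : x != 0 -> rescale x (lin1 y c) =
  fun m => x *: lin1 (y / x) (rescale x c) m.
Proof.
move=> x0; apply: funext => m; rewrite /rescale /lin1 !scalerBr !scalerA.
have -> : x ^ m = x * x ^ (m - 1) by rewrite -[in RHS](expr1z x) -expfzDr // addrC subrK.
by congr (_ - _ *: _); field.
Qed.

Lemma lin_exp_vanish K x y h : vanish_below K h -> vanish_below K (lin_exp x y h).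
Proof.
by move=> hK k kK; rewrite /lin_exp (expmul_vanish 1 hK) // hK // !scaler0 subr0.
Qed.

Lemma lins_exp_vanish K x T h : vanish_below K h -> vanish_below K (lins_exp x T h).
Proof. by move=> hK; elim: T => //= y T; apply: lin_exp_vanish. Qed.

Lemma lin_exp_linear K x y a h b g : vanish_below K h -> vanish_below K g ->
  lin_exp x y (fun k => a *: h k + b *: g k) =
  (fun k => a *: lin_exp x y h k + b *: lin_exp x y g k).
Proof.
move=> hK gK; apply: funext => k; rewrite /lin_exp (expmul_linear 1 a b hK gK).
rewrite /= !scalerDr !scalerN opprD addrACA !scalerA.
by rewrite ![x * _]mulrC ![y * _]mulrC.
Qed.

Lemma lins_exp_linear K x T a h b g : vanish_below K h -> vanish_below K g ->
  lins_exp x T (fun k => a *: h k + b *: g k) =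
  (fun k => a *: lins_exp x T h k + b *: lins_exp x T g k).
Proof.
move=> hK gK; elim: T => //= y T ->.
by apply: (lin_exp_linear (K := K)); apply: lins_exp_vanish.
Qed.

Lemma lin_expC K x y z h : vanish_below K h -> lin_exp x y (lin_exp x z h) =
  lin_exp x z (lin_exp x y h).
Proof.
move=> hK; have hz := expmul_vanish 1 hK; apply: funext => k.
have E u : expmul 1 (lin_exp x u h) k = x *: expmul 1 (expmul 1 h) k - u *: expmul 1 h k.
  rewrite -scaleNr -(expmul_linear 1 x (- u) hz hK); apply: eq_expmul => l.
  by rewrite /lin_exp scaleNr.
rewrite {1}/lin_exp [in RHS]/lin_exp !E /lin_exp !scalerBr subrACA_sub !scalerA.
by rewrite [y * z]mulrC [x * z]mulrC [x * y]mulrC.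
Qed.

Lemma lins_exp_perm K x T T' h : vanish_below K h -> perm_eq T T' -> lins_exp x T h =
  lins_exp x T' h.
Proof.
apply: (foldr_perm (P := vanish_below K)) => [y z g gK|y g gK];
  first exact: lin_expC gK.
exact: lin_exp_vanish.
Qed.

Lemma at_pt_exp_lin1 x y c : x != 0 -> fsupp c -> at_pt_exp x (lin1 y c) =
  lin_exp x y (at_pt_exp x c).
Proof.
move=> x0 cf; apply: funext => k; rewrite /at_pt_exp (rescale_lin1 _ _ x0) /lin_exp.
have cf' := fsupp_rescale x cf.
rewrite -(at_exp_shift 1 cf') -scaleNr -(at_exp_linear _ _ (fsupp_shift 1 cf') cf').
apply: eq_at_exp => m; rewrite /lin1 scalerBr scaleNr; congr (_ - _).
by rewrite scalerA mulrCA divff // mulr1.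
Qed.

Lemma at_pt_exp_lin1s x T c : x != 0 -> fsupp c -> at_pt_exp x (lin1s T c) =
  lins_exp x T (at_pt_exp x c).
Proof.
move=> x0 cf; elim: T => //= y T IH; rewrite at_pt_exp_lin1 ?IH //.
exact: fsupp_lin1s.
Qed.

Lemma at_pt_exp_vanish x c : vanish_below 0 (at_pt_exp x c).
Proof. exact: at_exp_vanish. Qed.

(** The factor x e^z - y vanishes at z = 0 only if y = x, and then to order one. *)
Lemma lin_exp_order x y j h : vanish_below j h ->
  vanish_below (j + (y == x)%:Z) (lin_exp x y h).
Proof.
move=> hj k kj; case: (ltP k j) => [|jk]; first exact: lin_exp_vanish.
have [yx|yx] := eqVneq y x; last by rewrite (negPf yx) addr0 ltNge jk in kj.
have -> : k = j by move: kj; rewrite yx eqxx; lia.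
by rewrite /lin_exp expmul_lead // yx subrr.
Qed.

Lemma lins_exp_order x T j h : vanish_below j h ->
  vanish_below (j + (count_mem x T)%:Z) (lins_exp x T h).
Proof.
move=> hj; elim: T => [|y T IH] /=; first by rewrite addr0.
by rewrite PoszD [X in j + X]addrC addrA; apply: lin_exp_order.
Qed.

Lemma lin_exp_order_inv x y K j h : x != 0 -> vanish_below K h ->
  vanish_below (j + (y == x)%:Z) (lin_exp x y h) ->
  vanish_below j h.
Proof.
move=> x0 hK hj.
suff hn (n : nat) k : k < K + n%:Z -> k < j -> h k = 0.
  by move=> k; apply: (hn `|k - K|.+1); lia.
elim: n k => [|n IH] k kn kj; first by apply: hK; lia.
have hk : vanish_below k h by move=> l lk; apply: IH; lia.
have [yx|yx] := eqVneq y x.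
  have := hj (k + 1);
    rewrite yx eqxx /lin_exp expmul_lead1 // scalerDr addrAC subrr add0r scale1r.
  by rewrite ltrD2r => /(_ kj) /eqP; rewrite scaler_eq0 (negPf x0) => /eqP.
have := hj k; rewrite (negPf yx) addr0 /lin_exp expmul_lead // -scalerBl => /(_ kj) /eqP.
by rewrite scaler_eq0 subr_eq0 eq_sym (negPf yx) => /eqP.
Qed.

Definition bounded_above A := exists N : int, forall m, N < m -> A m = 0.
Definition bounded_below A := exists N : int, forall m, m < N -> A m = 0.

Lemma bounded_above_lin1s T A : bounded_above A -> bounded_above (lin1s T A).
Proof.
move=> Au; elim: T => //= y T [N HN]; exists (N + 1) => m mN.
by rewrite /lin1 !HN ?scaler0 ?subr0 //; lia.
Qed.

Lemma bounded_below_lin1s T A : bounded_below A -> bounded_below (lin1s T A).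
Proof.
move=> Au; elim: T => //= y T [N HN]; exists N => m mN.
by rewrite /lin1 !HN ?scaler0 ?subr0 //; lia.
Qed.

Lemma bounded_fsupp A : bounded_above A -> bounded_below A -> fsupp A.
Proof. by move=> [N HN] [M HM]; apply: (fsupp_bounds (a := M) (b := N)). Qed.

(** The value at X = x of (X - x) Q is a telescoping sum: it is, up to a
    nonzero scalar, the coefficient Q_m for any m far below the support of (X - x) Q. *)
Lemma lin1_bounded_below x Q : x != 0 -> bounded_above Q -> bounded_below (lin1 x Q) ->
  at_pt_exp x (lin1 x Q) 0 = 0 -> bounded_below Q.
Proof.
move=> x0 [N HN] [M HM]; rewrite /at_pt_exp rescale_lin1 // divff //.
pose g := rescale x Q; have gN m : N < m -> g m = 0 by move=> /HN;
  rewrite /g /rescale => ->; rewrite scaler0.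
have PM m : m < M -> g (m - 1) - g m = 0.
  move=> /HM /(congr1 ( *:%R (x ^ m))); rewrite -[X in X = _]/(rescale x (lin1 x Q) m).
  rewrite rescale_lin1 // divff // scaler0 /lin1 scale1r => /eqP.
  by rewrite scaler_eq0 (negPf x0) => /eqP.
move=> val0; exists (M - 1) => m mM.
pose n := (absz (N + 1 - m)%R).+1.
have : at_exp (fun i => x *: lin1 1 g i) 0 = x *: g m.
  rewrite (@at_expE _ _ _ _ (irange (m + 1) n)) ?irange_uniq // => [|i].
    rewrite big_map (big_iota n (fun i : nat => exp_coef (m + 1 + i) 0 *: (x *: lin1 1 g (m + 1 + i)))).
    have tel (l : nat) :
      \sum_(i < l) (g (m + i%:Z) - g (m + i.+1%:Z)) = g m - g (m + l%:Z).
      elim: l => [|l IH]; first by rewrite big_ord0 addr0 subrr.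
      by rewrite big_ord_recr /= IH addrA subrK.
    transitivity (\sum_(i < n) x *: (g (m + i%:Z) - g (m + i.+1%:Z))).
      apply: eq_bigr => i _; rewrite exp_coef0 scale1r /lin1 scale1r.
      by congr (_ *: (g _ - g _)); lia.
    by rewrite -scaler_sumr tel [g (m + n%:Z)]gN ?subr0 //; rewrite /n; lia.
  rewrite mem_irange /lin1 scale1r => im; case: (ltP i M) => iM.
    by rewrite PM ?scaler0.
  by rewrite !gN ?subrr ?scaler0 //; move: im; rewrite /n; lia.
rewrite val0 /g /rescale => /esym/eqP.
by rewrite !scaler_eq0 (negPf x0) expfz_eq0 (negPf x0) andbF => /eqP.
Qed.

(** A and B are the expansions at infinity and at 0 of one rational function,
    with numerator [lin1s T A] and denominator the product of the X - x for x in T.  If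
    the numerator vanishes at each root to the order of the denominator, the function
    is a Laurent polynomial and the two expansions coincide.  The factors are cancelled
    one at a time. *)
Lemma eq_of_no_pole T A B : 0 \notin T -> bounded_above A -> bounded_below B ->
  lin1s T A = lin1s T B ->
  (forall x, x \in T -> vanish_below (count_mem x T) (at_pt_exp x (lin1s T A))) ->
    A = B.
Proof.
move=> + Au Bd; elim: T => //= x T IH;
  rewrite inE negb_or eq_sym => /andP[x0 T0] AB van.
pose QA := lin1s T A; pose QB := lin1s T B.
have QAu : bounded_above QA by apply: bounded_above_lin1s.
have QBd : bounded_below QB by apply: bounded_below_lin1s.
have QAd : bounded_below QA.
  apply: (lin1_bounded_below x0 QAu); last by apply: van; rewrite ?mem_head ?eqxx.
  by rewrite AB; apply: (bounded_below_lin1s [:: x]).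
have QAf := bounded_fsupp QAu QAd.
apply: IH => //.
  case: QAd QBd => [N HN] [M HM]; apply: funext.
  suff D (n : nat) m : m < Num.min N M + n%:Z -> QA m = QB m.
    by move=> m; apply: (D `|m - Num.min N M|.+1); lia.
  elim: n m => [|n IHn] m mn; first by rewrite HN ?HM //; lia.
  have /eqP := congr1 (fun c => c m) AB; rewrite /= /lin1 -/QA -/QB.
  rewrite (IHn (m - 1)); last by lia.
  by move=> /eqP /addrI /oppr_inj /(scalerI x0).
move=> y yT; have y0 : y != 0 by apply: contraNneq T0 => <-.
apply: (@lin_exp_order_inv y x 0 _ _ y0); first exact: at_pt_exp_vanish.
rewrite addrC -at_pt_exp_lin1 // -PoszD; apply: van.
by rewrite inE yT orbT.
Qed.

End OneVariable.

(** * Two expansions of a rational function *)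

Section Residues.
Context {F : numFieldType} {W : lmodType F}.
Implicit Types (A B c h : int -> W) (T : seq F) (x y : F) (m k s K : int) (a b : W).

(** These are the sequences killed by (X - x)^2, that is, the differences between
    the expansions at infinity and at 0 of functions with a double pole at x. *)
Definition exp_seq x a b m : W := x ^ (- m) *: (a - m%:~R *: b).
(** The expansions at infinity and at 0 of the rational function with its only pole
    at x and with principal part b z^-2 + a z^-1 in X = x e^z. *)
Definition principal_inf x a b m : W := if m < 0 then exp_seq x a b m else 0.
Definition principal_zero x a b m : W := if m < 0 then 0 else - exp_seq x a b m.
(** The numerator of that function over the denominator (X - x)^2, namely
    x a (X - x) + x b X. *)
Definition principal_num x a b m : W :=
  if m == 0 then - (x ^+ 2 *: a) else if m == 1 then x *: (a + b) else 0.

Lemma exp_seqE x a b m : exp_seq x a b m =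
  x ^ (- m) *: a + (- (x ^ (- m) * m%:~R)) *: b.
Proof. by rewrite /exp_seq scalerBr scalerA scaleNr. Qed.

Lemma lin_comb2 (u v u' v' z : F) a b :
  (u *: a + v *: b) - z *: (u' *: a + v' *: b) = (u - z * u') *: a + (v - z * v') *: b.
Proof. by rewrite scalerDr !scalerA opprD addrACA -!scalerBl. Qed.

Lemma exprzB1 x m : x != 0 -> x ^ (- (m - 1)) = x * x ^ (- m).
Proof. by move=> x0; rewrite opprB expfzDr // expr1z. Qed.

Lemma lin1_exp_seq x a b : x != 0 -> lin1 x (lin1 x (exp_seq x a b)) = fun=> 0.
Proof.
move=> x0; apply: funext => m; rewrite /lin1 !exp_seqE !lin_comb2 !exprzB1 //.
rewrite !rmorphB /=.
rewrite [X in X *: a](_ : _ = 0) ?[X in X *: b](_ : _ = 0) ?scale0r ?addr0 //; ring.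
Qed.

Lemma lin1_principal_inf x a b : x != 0 -> lin1 x (lin1 x (principal_inf x a b)) =
  principal_num x a b.
Proof.
move=> x0; apply: funext => m; have := congr1 (fun c => c m) (lin1_exp_seq a b x0).
rewrite /lin1 /= /principal_inf /principal_num.
have [m0|m0] := ltP m 0.
  have -> : m - 1 < 0 by lia.
  have -> : m - 1 - 1 < 0 by lia.
  move=> ->; have /negPf-> : m != 0 by lia.
  by have /negPf-> : m != 1 by lia.
move=> _; have [->|m1] := eqVneq m 0.
  rewrite /= scaler0 subr0 !exp_seqE !lin_comb2.
  rewrite -[- (0 - 1 - 1)]/(2%:Z) -[- (0 - 1)]/(1%:Z) -[0 - 1 - 1]/(- 2%:Z)
    -[0 - 1]/(- 1%:Z).
  rewrite expr1z -[x ^ 2%:Z]/(x ^+ 2) -scaleNr -[RHS]addr0; congr (_ + _).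
    by congr (_ *: _); ring.
  by rewrite [X in X *: b](_ : _ = 0) ?scale0r //; ring.
have [->|mn1] := eqVneq m 1.
  rewrite subrr /= !(scaler0, subr0) exp_seqE -[- (0 - 1)]/(1%:Z) -[0 - 1]/(- 1%:Z)
    expr1z scalerDr.
  by congr (_ + _ *: b); ring.
have /negPf-> : ~~ (m - 1 < 0) by lia.
have /negPf-> : ~~ (m - 1 - 1 < 0) by lia.
by rewrite !(scaler0, subr0).
Qed.

Lemma principal_inf_zero x a b m : principal_inf x a b m - principal_zero x a b m =
  exp_seq x a b m.
Proof. by rewrite /principal_inf /principal_zero; case: ifP => _;
  rewrite ?subr0 ?sub0r ?opprK. Qed.

Lemma lin1_principal_zero x a b : x != 0 -> lin1 x (lin1 x (principal_zero x a b)) =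
  principal_num x a b.
Proof.
move=> x0; rewrite -lin1_principal_inf //.
have := lin1_exp_seq a b x0; have -> :
  exp_seq x a b = fun m => principal_inf x a b m - principal_zero x a b m.
  by apply: funext => m; rewrite principal_inf_zero.
rewrite -[lin1 x (lin1 x _)]/(lin1s [:: x; x] _) lin1sB => E.
apply: funext => m; have /eqP := congr1 (fun c => c m) E.
by rewrite subr_eq0 => /eqP.
Qed.

Lemma fsupp_principal_num x a b : fsupp (principal_num x a b).
Proof.
exists [:: 0; 1] => m; rewrite !inE negb_or => /andP[m0 m1].
by rewrite /principal_num (negPf m0) (negPf m1).
Qed.

Lemma at_pt_exp_principal_num x a b k : at_pt_exp x (principal_num x a b) k =
  exp_coef 0 k *: (- (x ^+ 2 *: a)) + exp_coef 1 k *: (x ^+ 2 *: (a + b)).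
Proof.
rewrite /at_pt_exp (@at_expE _ _ _ _ [:: 0; 1]) // => [|m]; last first.
  rewrite !inE negb_or => /andP[m0 m1].
  by rewrite /rescale /principal_num (negPf m0) (negPf m1) scaler0.
by rewrite big_cons big_seq1 /rescale /principal_num /= expr0z scale1r expr1z
  [x *: (x *: _)]scalerA -expr2.
Qed.

Lemma exp_coef12 : exp_coef 1 2 = 2^-1 :> F.
Proof. by rewrite -[LHS]/(expz 1 2) /expz expr1n mul1r. Qed.

Lemma expmul_lead2 k h : vanish_below k h -> expmul 1 h (k + 2) =
  h (k + 2) + h (k + 1) + 2^-1 *: h k.
Proof.
move=> hk; rewrite (expmul_ord (n := 3) 1 hk) ?ltrD2l // !big_ord_recl big_ord0 /=
  subr0.
rewrite -[expz 1 0]/(exp_coef 1 0) -[expz 1 (bump 0 0)]/(exp_coef 1 1)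
  -[expz 1 _]/(exp_coef 1 2).
rewrite exp_coef0 exp_coef1 exp_coef12 !scale1r addr0 addrA;
  congr (_ + h _ + _ *: h _); rewrite /bump /=; lia.
Qed.

(** A Laurent series with a pole of order two and the function built from
    its two polar coefficients differ by a power series; multiplied by
    (x e^z - x)^2, their difference is divisible by z^2. *)
Lemma lin_exp_principal x h : vanish_below (- 2) h ->
  vanish_below 2 (fun k => lin_exp x x (lin_exp x x h) k -
    at_pt_exp x (principal_num x (h (- 1)) (h (- 2))) k).
Proof.
move=> h2; pose g := lin_exp x x h.
have gbd : vanish_below (- 1) g by have := lin_exp_order (x := x) (y := x) h2;
  rewrite eqxx.
have Gbd : vanish_below 0 (lin_exp x x g)
  by have := lin_exp_order (x := x) (y := x) gbd; rewrite eqxx.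
have hN1 : expmul 1 h (- 1) = h (- 1) + 1%:~R *: h (- 2) := expmul_lead1 1 h2.
have h0 : expmul 1 h 0 = h 0 + h (- 1) + 2^-1 *: h (- 2) := expmul_lead2 h2.
have gm0 : expmul 1 g 0 = g 0 + 1%:~R *: g (- 1) := expmul_lead1 1 gbd.
have gm1 : expmul 1 g 1 = g 1 + g 0 + 2^-1 *: g (- 1) := expmul_lead2 gbd.
have gN1 : g (- 1) = x *: h (- 2).
  by rewrite /g /lin_exp hN1 scale1r scalerDr addrAC subrr add0r.
have g0 : g 0 = x *: h (- 1) + (x * 2^-1) *: h (- 2).
  by rewrite /g /lin_exp h0 !scalerDr scalerA addrAC [X in X + _]addrAC subrr add0r.
rewrite -/g; clearbody g.
move=> k k2; case: (ltP k 0) => k0.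
  by rewrite (Gbd _ k0) at_pt_exp_principal_num !exp_coef_lt0 // !scale0r addr0 subr0.
rewrite at_pt_exp_principal_num /lin_exp; have [->|kn0] := eqVneq k 0.
  rewrite !exp_coef0 !scale1r gm0 scale1r scalerDr [X in X - _]addrAC subrr add0r gN1
    scalerA -expr2.
  by rewrite scalerDr addrA addNr add0r subrr.
have -> : k = 1 by lia.
rewrite !exp_coef1 scale0r add0r scale1r gm1 !scalerDr [X in X - _]addrAC.
rewrite [X in X + _ - _]addrAC subrr add0r.
rewrite g0 gN1 scalerDr !scalerA -[X in X - _]addrA -scalerDl.
rewrite (_ : x * (x * 2^-1) + x * 2^-1 * x = x ^+ 2) -?expr2 ?subrr //.
by field.
Qed.

Lemma at_pt_expB x c d : fsupp c -> fsupp d ->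
  at_pt_exp x (fun m => c m - d m) = fun k => at_pt_exp x c k - at_pt_exp x d k.
Proof.
move=> cf df; apply: funext => k;
  have := at_exp_linear 1 (- 1) (fsupp_rescale x cf) (fsupp_rescale x df) k.
rewrite scale1r scaleN1r => <-; apply: eq_at_exp => m.
by rewrite /rescale scale1r scaleN1r scalerBr.
Qed.

Lemma at_pt_exp_sum x (r : seq F) (c : F -> int -> W) : (forall y, fsupp (c y)) ->
  at_pt_exp x (fun m => \sum_(y <- r) c y m) = fun k => \sum_(y <- r) at_pt_exp x (c y) k.
Proof.
move=> cf; apply: funext => k.
have := @at_exp_sum _ _ _ r (fun=> 1) (fun y => rescale x (c y)) k (fun y => fsupp_rescale x (cf y)).
under eq_bigr do rewrite scale1r.
move=> <-; apply: eq_at_exp => m; rewrite /rescale scaler_sumr.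
by apply: eq_bigr => y _; rewrite scale1r.
Qed.

Lemma lin1s_cat T x c : lin1s (T ++ [:: x; x]) c = lin1s T (lin1 x (lin1 x c)).
Proof. by rewrite /lin1s foldr_cat. Qed.

Lemma vanish_belowB K g h : vanish_below K g -> vanish_below K h ->
  vanish_below K (fun k => g k - h k).
Proof. by move=> gK hK k kK; rewrite gK // hK // subr0. Qed.

Lemma sub_swap (V : zmodType) (u v p r : V) : u - p = v - r -> u - v = p - r.
Proof.
by move=> /eqP; rewrite subr_eq => /eqP->; rewrite addrAC [v - r]addrC addrK addrC.
Qed.

(** Subtracting from A and B the expansions of the principal part at each x in T
    leaves the two expansions of a function without poles, so that A - B is the sum
    over the poles of the differences of the two expansions. *)
Lemma residue_formula T A B (a b : F -> W) : 0 \notin T -> bounded_above A ->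
  bounded_below B ->
  lin1s T A = lin1s T B -> (forall x, x \in T -> (2 <= count_mem x T)%N) ->
  (forall x, x \in T -> exists h, [/\ vanish_below (- 2) h, h (- 1) = a x, h (- 2) = b x
     & at_pt_exp x (lin1s T A) = lins_exp x T h]) ->
  forall m, A m - B m = \sum_(x <- undup T) x ^ (- m) *: (a x - m%:~R *: b x).
Proof.
move=> T0 Au Bd AB T2 Th m.
pose A' n := A n - \sum_(x <- undup T) principal_inf x (a x) (b x) n.
pose B' n := B n - \sum_(x <- undup T) principal_zero x (a x) (b x) n.
have neq0 x : x \in T -> x != 0 by apply: contraTneq => ->.
pose N x := lin1s (rem x (rem x T)) (principal_num x (a x) (b x)).
have T2' x : x \in T -> perm_eq T (rem x (rem x T) ++ [:: x; x]).
  move=> xT; rewrite perm_sym perm_catC /= perm_sym.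
  apply: perm_trans (perm_to_rem xT) _; rewrite perm_cons; apply: perm_to_rem.
  have /permP/(_ (pred1 x)) := perm_to_rem xT.
  rewrite -has_pred1 has_count; have := T2 x xT; rewrite /= eqxx; lia.
have NA x : x \in T -> lin1s T (principal_inf x (a x) (b x)) = N x.
  by move=> xT; rewrite (lin1s_perm _ (T2' x xT)) lin1s_cat lin1_principal_inf // neq0.
have NB x : x \in T -> lin1s T (principal_zero x (a x) (b x)) = N x.
  by move=> xT; rewrite (lin1s_perm _ (T2' x xT)) lin1s_cat lin1_principal_zero // neq0.
have sumA : lin1s T (fun n => \sum_(x <- undup T) principal_inf x (a x) (b x) n)
    = fun n => \sum_(x <- undup T) N x n.
  rewrite (lin1s_sum _ _ (fun x => principal_inf x (a x) (b x))); apply: funext => n.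
  by apply: eq_big_seq => x; rewrite mem_undup => xT; rewrite NA.
have sumB : lin1s T (fun n => \sum_(x <- undup T) principal_zero x (a x) (b x) n)
    = fun n => \sum_(x <- undup T) N x n.
  rewrite (lin1s_sum _ _ (fun x => principal_zero x (a x) (b x))); apply: funext => n.
  by apply: eq_big_seq => x; rewrite mem_undup => xT; rewrite NB.
have Nf x : fsupp (N x) by apply: fsupp_lin1s; apply: fsupp_principal_num.
suff AB' : A' = B'.
  rewrite (sub_swap (congr1 (fun c => c m) AB')) -sumrB.
  by apply: eq_bigr => x _; rewrite principal_inf_zero.
have Au' : bounded_above A'.
  have [M AM] := Au; exists (Num.max M 0) => n; rewrite gt_max => /andP[nM n0].
  rewrite /A' AM // big1 ?subr0 // => x _.
  by rewrite /principal_inf ltNge (ltW n0).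
have Bd' : bounded_below B'.
  have [M BM] := Bd; exists (Num.min M 0) => n; rewrite lt_min => /andP[nM n0].
  by rewrite /B' BM // big1 ?subr0 // => x _; rewrite /principal_zero n0.
apply: (eq_of_no_pole (T := T)) => //; first by rewrite /A' /B' !lin1sB sumA sumB AB.
have Pf : fsupp (lin1s T A).
  by apply: bounded_fsupp;
    [apply: bounded_above_lin1s | rewrite AB; apply: bounded_below_lin1s].
have Sf : fsupp (fun n => \sum_(x <- undup T) N x n).
  have := (fsum_sum (undup T) (fun=> 1) Nf).1; congr fsupp.
  by apply: funext => n; apply: eq_bigr => x _; rewrite scale1r.
move=> x xT; rewrite /A' lin1sB sumA at_pt_expB // at_pt_exp_sum //.
have x0 := neq0 x xT; set T1 := rem x (rem x T).
have cT : count_mem x T = (count_mem x T1 + 2)%N.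
  by rewrite (permP (T2' x xT)) count_cat /= eqxx.
have [h [h2 ha hb hT]] := Th x xT.
have -> : (fun k => at_pt_exp x (lin1s T A) k - \sum_(y <- undup T) at_pt_exp x (N y) k) =
   (fun k => (at_pt_exp x (lin1s T A) k - at_pt_exp x (N x) k) -
      \sum_(y <- undup T | y != x) at_pt_exp x (N y) k).
  apply: funext => k; rewrite [in LHS](bigD1_seq x) ?undup_uniq ?mem_undup //=.
  by rewrite opprD addrA.
apply: vanish_belowB.
  rewrite hT (lins_exp_perm _ h2 (T2' x xT)) /lins_exp foldr_cat /=
    -/(lins_exp _ _ _) -/T1.
  rewrite /N -/T1 at_pt_exp_lin1s //; last exact: fsupp_principal_num.
  have bd1 : vanish_below (- 2) (lin_exp x x (lin_exp x x h)) by do 2!apply: lin_exp_vanish.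
  have bd2 : vanish_below (- 2) (at_pt_exp x (principal_num x (a x) (b x))).
    by apply: (vanish_belowW (K := 0)) => //; apply: at_pt_exp_vanish.
  have := @lins_exp_order _ _ x T1 _ _ (lin_exp_principal x h2).
  have -> : (fun k => lin_exp x x (lin_exp x x h) k - at_pt_exp x (principal_num x (h (-1)) (h (-2))) k) =
     (fun k => 1 *: lin_exp x x (lin_exp x x h) k + (-1) *: at_pt_exp x (principal_num x (a x) (b x)) k).
    by apply: funext => k; rewrite scale1r scaleN1r ha hb.
  rewrite (lins_exp_linear _ _ _ _ bd1 bd2) cT PoszD addrC; congr vanish_below.
  by apply: funext => k; rewrite scale1r scaleN1r.
move=> k kT; rewrite big_seq_cond big1 // => y; rewrite mem_undup => /andP[yT yx].
rewrite /N at_pt_exp_lin1s //; last exact: fsupp_principal_num.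
have := @lins_exp_order _ _ x (rem y (rem y T)) _ _ (@at_pt_exp_vanish _ _ x (principal_num y (a y) (b y))).
rewrite add0r; apply.
have := permP (T2' y yT) (pred1 x); rewrite count_cat /= (negPf yx) !addn0 => <-.
exact: kT.
Qed.

End Residues.

(** * Products of linear factors under changes of variables *)

Section Factors.
Context {F : numFieldType} {W : lmodType F}.
Implicit Types (c p : {poly F}) (f g : {poly {poly F}}) (A : int -> int -> W) (T : seq F).

Lemma poly_actBZ p y c (u : int -> W) s :
  poly_act (p - y *: c) u s = poly_act p u s - y *: poly_act c u s.
Proof.
pose n := maxn (size (p - y *: c)) (maxn (size p) (size c)).
rewrite !(@poly_act_bound _ _ n) ?leq_max ?leqnn ?orbT // scaler_sumr -sumrB.
by apply: eq_bigr => j _; rewrite coefB coefZ scalerBl scalerA.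
Qed.

Lemma poly_act2_bound n f A m k : (size f <= n)%N ->
  poly_act2 f A m k = \sum_(i < n) poly_act f`_i (A (m - i%:Z)) k.
Proof.
move=> fn; rewrite /poly_act2 /csum
  (big_ord_widen n (fun i => poly_act f`_i (A (m - i%:Z)) k) fn).
rewrite big_mkcond; apply: eq_bigr => i _; case: ltnP => // /leq_sizeP->//.
by rewrite /poly_act size_poly0 big_ord0.
Qed.

Lemma poly_act2_factor y g A : poly_act2 (('X - (y *: 'X)%:P) * g) A =
  lin2 y (poly_act2 g A).
Proof.
apply: funext => m; apply: funext => n; rewrite /lin2.
have sz : (size (('X - (y *: 'X)%:P) * g)%R <= (size g).+1)%N.
  by rewrite (leq_trans (size_polyMleq _ _)) // size_XsubC.
have co i : (('X - (y *: 'X)%:P) * g)`_i = (if i is i'.+1 then g`_i' else 0) - y *: (g`_i * 'X^1).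
  by rewrite mulrBl coefB coefXM coefCM expr1 -scalerAl mulrC; case: i.
rewrite (poly_act2_bound _ _ _ sz);
  under eq_bigr => i _ do rewrite co poly_actBZ poly_actMXn.
rewrite sumrB -scaler_sumr -(poly_act2_bound _ _ _ (leqnSn _)); congr (_ - _).
rewrite big_ord_recl {1}/poly_act size_poly0 big_ord0 add0r
  (poly_act2_bound _ _ _ (leqnn _)).
by apply: eq_bigr => i _; rewrite /= -addrA -opprD.
Qed.

Lemma poly_act2_prod (I : Type) (r : seq I) (y : I -> F) A :
  poly_act2 (\prod_(i <- r) ('X - (y i *: 'X)%:P)) A = lin2s (map y r) A.
Proof.
elim: r => [|i r IH] /=; last by rewrite big_cons poly_act2_factor IH.
rewrite big_nil; apply: funext => m; apply: funext => n.
rewrite /poly_act2 /csum size_poly1 big_ord1 coef1 /= size_poly1 big_ord1 coef1.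
by rewrite !subr0 scale1r.
Qed.

Lemma line_lin2 y A s : line (s + 1) (lin2 y A) = lin1 y (line s A).
Proof.
by apply: funext => m; rewrite /line /lin2 /lin1; congr (A _ _ - _ *: A _ _); lia.
Qed.

Lemma line_lin2s T A s : line (s + (size T)%:Z) (lin2s T A) = lin1s T (line s A).
Proof.
elim: T => [|y T IH] /=; first by rewrite addr0.
by rewrite -addn1 PoszD addrA line_lin2 IH.
Qed.

Lemma lin2s_exp_line T (H : int -> int -> W) k s :
  lin2s_exp T H k (s + (size T)%:Z) = lins_exp 1 T (fun k => H k s) k.
Proof.
elim: T k => [|y T IH] k /=; first by rewrite addr0.
rewrite {1}/lin2_exp /lin_exp -addn1 PoszD addrA addrK IH scale1r; congr (_ - _).
by apply: eq_expmul => l; rewrite IH.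
Qed.

Lemma lin2C x y A : lin2 x (lin2 y A) = lin2 y (lin2 x A).
Proof.
apply: funext => m; apply: funext => n; rewrite /lin2 !scalerBr subrACA_sub !scalerA.
by rewrite mulrC.
Qed.

Lemma lin2s_perm T T' A : perm_eq T T' -> lin2s T A = lin2s T' A.
Proof.
by apply: (foldr_perm (P := fun=> True)) => // x y z _; apply: lin2C.
Qed.

Lemma quadrant_lin2s_cat T T' A : quadrant (lin2s T' A) -> quadrant (lin2s (T ++ T') A).
Proof. by rewrite /lin2s foldr_cat; apply: quadrant_lin2s. Qed.

Lemma lin2s_scale x T A m n : x != 0 ->
  lin2s (map (fun y => y / x) T) (fun m n => x ^ m *: A m n) m n
  = x ^ (m - (size T)%:Z) *: lin2s T A m n.
Proof.
move=> x0; elim: T m n => [|y T IH] m n /=; first by rewrite subr0.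
rewrite /lin2 !IH scalerBr !scalerA -addn1 PoszD.
have -> : m - 1 - (size T)%:Z = m - ((size T)%:Z + 1) by lia.
congr (_ - _ *: _); have -> : m - (size T)%:Z = m - ((size T)%:Z + 1) + 1 by lia.
by rewrite expfzDr // expr1z; field.
Qed.

Lemma quadrant_scale x T A : x != 0 -> quadrant (lin2s T A) ->
  quadrant (lin2s (map (fun y => y / x) T) (fun m n => x ^ m *: A m n)).
Proof.
by move=> x0 [N AN]; exists N => m n mn; rewrite lin2s_scale // AN // scaler0.
Qed.

Lemma rescale_lin1s x T (c : int -> W) : x != 0 ->
  rescale x (lin1s T c) =
  fun m => x ^+ size T *: lin1s (map (fun y => y / x) T) (rescale x c) m.
Proof.
move=> x0; elim: T => [|y T IH] /=; first by apply: funext => m; rewrite scale1r.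
rewrite rescale_lin1 // IH; apply: funext => m; rewrite exprS -[RHS]scalerA /lin1;
  congr (_ *: _).
by rewrite scalerBr !scalerA [y / x * _]mulrC.
Qed.

Lemma lins_exp_scale x T K (h : int -> W) : x != 0 -> vanish_below K h ->
  lins_exp x T h = fun k => x ^+ size T *: lins_exp 1 (map (fun y => y / x) T) h k.
Proof.
move=> x0 hK; elim: T => [|y T IH] /=; first by apply: funext => k; rewrite scale1r.
set g := lins_exp 1 _ h in IH *; have gK : vanish_below K g by apply: lins_exp_vanish.
rewrite IH; apply: funext => k; rewrite /lin_exp.
have := expmul_linear 1 (x ^+ size T) 0 gK gK k; rewrite scale0r addr0.
have -> : (fun k => x ^+ size T *: g k + 0 *: g k) = (fun k => x ^+ size T *: g k).
  by apply: funext => l; rewrite scale0r addr0.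
move=> ->; rewrite exprS scale1r scalerBr !scalerA; congr (_ - _ *: _).
by field.
Qed.

(** The exchange of x1 and x2 replaces X by 1/X, and X - y by -y (X - 1/y) up to a
    power of X. *)
Lemma lin1s_rev s T (c : int -> W) : 0 \notin T ->
  lin1s T (fun m => c (s - m)) = fun m => (\prod_(y <- T) - y) *:
    lin1s (map (fun y => y^-1) T) c (s + (size T)%:Z - m).
Proof.
elim: T => [|y T IH] /=; first by move=> _; apply: funext => m;
  rewrite big_nil scale1r addr0.
rewrite inE negb_or eq_sym => /andP[y0 /IH->]; apply: funext => m.
rewrite big_cons /lin1 scalerBr !scalerA -addn1 PoszD.
have -> : s + ((size T)%:Z + 1) - m - 1 = s + (size T)%:Z - m by lia.
have -> : s + ((size T)%:Z + 1) - m = s + (size T)%:Z - (m - 1) by lia.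
set p := \prod_(_ <- _) _.
have -> : - y * p / y = - p by field.
by rewrite mulNr !scaleNr opprK addrC.
Qed.

(** The counterpart of [lin1s_rev] on expansions at X = e^z, where X -> 1/X
    becomes z -> -z. *)
Lemma lins_exp_rev s T K (h : int -> W) : 0 \notin T -> vanish_below K h ->
  (fun k => (\prod_(y <- T) - y) *:
    expmul (s + (size T)%:Z) (reflect_z (lins_exp 1 (map (fun y => y^-1) T) h)) k)
  = lins_exp 1 T (expmul s (reflect_z h)).
Proof.
move=> + hK; elim: T => [|y T IH] /=.
  by move=> _; apply: funext => k; rewrite big_nil scale1r addr0.
rewrite inE negb_or eq_sym => /andP[y0 /IH <-]; apply: funext => k.
set g := lins_exp 1 _ h; have gK : vanish_below K g by apply: lins_exp_vanish.
have zgK := reflect_z_vanish gK; set p := \prod_(i <- T) _; set t := s + (size T)%:Z.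
have -> : reflect_z (lin_exp 1 y^-1 g) = fun k => 1 *: expmul (-1) (reflect_z g) k + (- y^-1) *: reflect_z g k.
  have -> : lin_exp 1 y^-1 g = fun k => 1 *: expmul 1 g k + (- y^-1) *: g k.
    by apply: funext => l; rewrite /lin_exp scaleNr.
  by apply: funext => l; rewrite reflect_z_linear (reflect_z_expmul 1 gK).
rewrite (expmul_linear _ _ _ (expmul_vanish (-1) zgK) zgK) (expmulD _ _ zgK) big_cons
  -/p.
have -> : s + (size T).+1%:Z + -1 = t by rewrite /t; lia.
have -> : s + (size T).+1%:Z = 1 + t by rewrite /t; lia.
rewrite /lin_exp.
have ztK := expmul_vanish t zgK.
have := expmul_linear 1 p 0 ztK ztK k; rewrite scale0r addr0.
have -> : (fun k => p *: expmul t (reflect_z g) k + 0 *: expmul t (reflect_z g) k) = (fun k => p *: expmul t (reflect_z g) k).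
  by apply: funext => l; rewrite scale0r addr0.
move=> ->; rewrite !scale1r scalerDr !scalerA addrC.
have -> : - y * p * - y^-1 = p by field.
by rewrite mulNr scaleNr (expmulD _ _ zgK).
Qed.

End Factors.

(** * Images of linear combinations *)

Section LinearProp.
Context {F : fieldType} {U W : lmodType F} (f : U -> W).
Hypothesis f_lin : linear f.

Lemma linear_0 : f 0 = 0.
Proof. by have := f_lin (-1) 0 0; rewrite !scaleN1r !addNr. Qed.

Lemma linear_D x y : f (x + y) = f x + f y.
Proof. by have := f_lin 1 x y; rewrite !scale1r. Qed.

Lemma linear_Z a x : f (a *: x) = a *: f x.
Proof. by have := f_lin a x 0; rewrite linear_0 !addr0. Qed.

Lemma linear_B x y : f (x - y) = f x - f y.
Proof. by rewrite linear_D -scaleN1r linear_Z scaleN1r. Qed.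

Lemma linear_sum_scale (I : Type) (r : seq I) (a : I -> F) (x : I -> U) :
  f (\sum_(i <- r) a i *: x i) = \sum_(i <- r) a i *: f (x i).
Proof.
elim: r => [|i r IH]; first by rewrite !big_nil linear_0.
by rewrite !big_cons f_lin IH.
Qed.

End LinearProp.

(** * Skew-symmetry in a vertex algebra *)

Section VertexAlgebraFacts.
Context {F : numFieldType} {V : lmodType F}.
Variables (vac : V) (Y : V -> int -> V -> V).
Hypothesis Y_va : vertex_algebra vac Y.

Lemma binz0 p : binz p 0 = 1 :> F.
Proof. by rewrite /binz big_ord0 fact0 divr1. Qed.

Lemma binzN1 i : binz (- 1) i = (- 1) ^+ i :> F.
Proof.
rewrite /binz; have -> : \prod_(j < i) ((- 1 - j%:Z)%:~R : F) = (- 1) ^+ i * (i`!)%:R.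
  elim: i => [|i IH]; first by rewrite big_ord0 fact0 mulr1.
  rewrite big_ord_recr IH /= factS natrM exprS.
  have -> : (-1 - i%:Z)%:~R = - (i.+1)%:R :> F by rewrite -opprD mulrNz -PoszD add1n.
  by ring.
by rewrite mulfK // factF_neq0.
Qed.

(** The Jacobi identity applied to the vacuum, with p = -1 and q = 0: on one side
    all terms but one are killed by the creation property. *)
Lemma skew_symmetry u v r N :
  (forall n, N <= n -> Y u n v = 0) -> forall n : nat, N <= r + n%:Z ->
  Y v r u = - (- 1) ^ r *:
    \sum_(i < n) ((- 1) ^+ i : F) *: Y (Y u (r + i%:Z) v) (- 1 - i%:Z) vac.
Proof.
move=> uN n rn; have := va_jacobi Y_va u v vac (-1) 0 r.
have lhs0 i : i \notin iota 0 n ->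
  binz (-1) i *: Y (Y u (r + i%:Z) v) (-1 + 0 - i%:Z) vac = 0.
  rewrite mem_iota => ni; rewrite uN; last by lia.
  by rewrite (linear_0 (va_linearl Y_va _ vac)) scaler0.
rewrite (fsbig_uniq (iota_uniq 0 n) lhs0) big_iota.
rewrite (@fsbig_uniq _ _ _ [:: 0%N]) // => [|i].
  have e0 : 0 + 0%:Z = 0%:Z by [].
  have e1 : - 1 + 0%:Z = - 1 by [].
  have e2 : 0 + r - 0%:Z = r by lia.
  rewrite big_seq1 binz0 expr0 mulr1 scale1r e0 e1 e2.
  rewrite (va_creation Y_va v 0) (va_creation1 Y_va) (linear_0 (va_linearr Y_va u _)).
  rewrite sub0r => /(congr1 (fun w => - (-1) ^ r *: w)).
  rewrite !scaleNr scalerN opprK scalerA -expfzMl mulrNN mulr1 exp1rz scale1r => <-.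
  congr (- (_ *: _)); apply: eq_bigr => i _.
  by rewrite binzN1.
rewrite inE => i0; rewrite !add0r (va_creation Y_va v i)
  (linear_0 (va_linearr Y_va u _)) sub0r.
have -> : -1 + i%:Z = i.-1%:Z by case: i i0 => // i _; lia.
by rewrite (va_creation Y_va u) (linear_0 (va_linearr Y_va v _)) scaler0 oppr0 scaler0.
Qed.

End VertexAlgebraFacts.

(** * Iterates in a phi-coordinated quasi module *)

Section QuasiModule.
Context {F : numFieldType} {V W : lmodType F}.
Variables (vac : V) (Y : V -> int -> V -> V) (YW : V -> int -> W -> W).
Hypothesis Y_va : vertex_algebra vac Y.
Hypothesis W_mod : phi_quasi_module vac Y YW.

(** The products Y_W(u, x1) Y_W(v, x2) w and the iterates Y_W(Y(u, z) v, x2) w. *)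
Definition product_coef u v w : int -> int -> W := fun m n => YW u m (YW v n w).
Definition iterate_coef u v w : int -> int -> W := fun k s => YW (Y u (- k - 1) v) s w.

Lemma YW_linearl n w : linear (fun v => YW v n w).
Proof. exact: phi_linear W_mod n w. Qed.

Lemma YW_linearr v n : linear (YW v n).
Proof. exact: (phi_field W_mod v).1. Qed.

Lemma iterate_coef_vanish u v w : exists K, vanish_below2 K (iterate_coef u v w).
Proof.
have [N YN] := va_trunc Y_va u v; exists (- N) => s k kN.
by rewrite /iterate_coef YN ?(linear_0 (YW_linearl s w)) //; lia.
Qed.

Lemma iterate_coef_truncated u v w k : exists N : int, forall s, s < N ->
  iterate_coef u v w k s = 0.
Proof. by have [N HN] := (phi_field W_mod (Y u (- k - 1) v)).2 w; exists N. Qed.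

Lemma field2_quadrant (A : int -> int -> W -> W) w : field2 A ->
  quadrant (fun m n => A m n w).
Proof. by move=> [_ /(_ w)]. Qed.

Lemma product_iterate T u v w : quadrant (lin2s T (product_coef u v w)) -> forall k s,
  lines_at_exp (lin2s T (product_coef u v w)) k s = lin2s_exp T (iterate_coef u v w) k s.
Proof.
move=> qT; have [f [f0 ff fa]] := phi_assoc W_mod u v.
have [K HK] := iterate_coef_vanish u v w.
apply: (@associativity_transfer _ _ f T _ _ K f0 qT (field2_quadrant w ff) HK (iterate_coef_truncated u v w)).
move=> k s; transitivity (subst_exp (mul2 f (comp2 (YW u) (YW v))) k s w).
  by case: k => // k; rewrite (lines_at_exp_vanish _).
rewrite fa /mul_exp /poly_act_exp /csum; apply: eq_bigr => i _; apply: eq_bigr => j _.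
by rewrite (expmul_fsbig _ _ (HK _)).
Qed.

Lemma product_iterate_line T u v w : quadrant (lin2s T (product_coef u v w)) -> forall s,
  at_exp (lin1s T (line s (product_coef u v w))) = lins_exp 1 T (fun k => iterate_coef u v w k s).
Proof.
move=> qT s; apply: funext => k; rewrite -line_lin2s -lin2s_exp_line.
exact: product_iterate qT k _.
Qed.

(** Associativity for v = 1, where the product Y_W(u, x1) Y_W(1, x2) is already
    regular, says Y_W(e^{zD} u, x) = Y_W(u, x e^z). *)
Lemma YW_deriv u (a : nat) s w : YW (Y u (- a%:Z - 1) vac) s w = expz s a *: YW u s w.
Proof.
have q : quadrant (lin2s [::] (product_coef u vac w)).
  have [N uN] := (phi_field W_mod u).2 w.
  exists (Num.min N 0) => m n mn; rewrite /= /product_coef (phi_vac W_mod).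
  case: eqP => n0; last exact: (linear_0 (YW_linearr u m)).
  by apply: uN; move: mn; rewrite n0; lia.
have /(congr1 (fun h => h a%:Z)) := product_iterate_line q s; move=> /= E;
  rewrite -[LHS]/(iterate_coef u vac w a s) -E.
rewrite (@at_expE _ _ _ _ [:: s]) // => [|m].
  by rewrite big_seq1 /line /product_coef (phi_vac W_mod) subrr eqxx.
rewrite inE => ms; rewrite /line /product_coef (phi_vac W_mod) subr_eq0 eq_sym
  (negPf ms).
exact: (linear_0 (YW_linearr u m)).
Qed.

(** Skew-symmetry Y(u, z) v = e^{zD} Y(v, -z) u; in degree s, the operator
    e^{zD} acts as e^{sz}. *)
Lemma iterate_coef_skew u v w s :
  (fun k => iterate_coef u v w k s) = expmul s (reflect_z (fun k => iterate_coef v u w k s)).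
Proof.
have [N vN] := va_trunc Y_va v u.
have hK : vanish_below (- N) (fun k => iterate_coef v u w k s).
  by move=> k kN; rewrite /iterate_coef vN ?(linear_0 (YW_linearl s w)) //; lia.
apply: funext => k; pose n := (absz (k + N)%R).+1.
rewrite {1}/iterate_coef (skew_symmetry Y_va vN (n := n)); last by rewrite /n; lia.
rewrite (expmul_ord (n := n) s (reflect_z_vanish hK)); last by rewrite /n; lia.
rewrite (linear_Z (YW_linearl s w)) (linear_sum_scale (YW_linearl s w)) scaler_sumr.
apply: eq_bigr => i _; have := YW_deriv (Y v (- k - 1 + i%:Z) u) i s w.
have -> : - i%:Z - 1 = - 1 - i%:Z by lia.
move=> ->; rewrite /reflect_z /iterate_coef !scalerA.
have -> : - (k - i%:Z) - 1 = - k - 1 + i%:Z by lia.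
congr (_ *: _); rewrite mulrA [expz s i * _]mulrC; congr (_ * _).
have N1_opp j : (-1 : F) ^ (- j) = (-1) ^ j by rewrite -exprz_inv invrN1.
rewrite !expfzDr ?N1_neq0 // !N1_opp -[(-1) ^+ i]/((-1 : F) ^ i%:Z).
by rewrite expr1z mulrN1 opprK.
Qed.

End QuasiModule.

(** * The commutator formula *)

Section Commutator.
Context {F : numFieldType} {V W : lmodType F}.
Variables (vac : V) (Y : V -> int -> V -> V) (YW : V -> int -> W -> W).
Variables (q : F) (tau : int -> V -> V).
Hypothesis Y_va : vertex_algebra vac Y.
Hypothesis W_mod : phi_quasi_module vac Y YW.
Hypothesis W_equiv : equivariant q tau YW.
Hypothesis q0 : q != 0.
Hypothesis q_root : forall n : nat, (0 < n)%N -> q ^+ n != 1.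

Let prd := product_coef YW.

Lemma qexp_neq0 r : q ^ r != 0.
Proof. exact: expfz_neq0. Qed.

(** The poles q^r are distinct because q is not a root of unity. *)
Lemma qexp_inj : injective (fun r : int => q ^ r).
Proof.
suff E (r : int) : q ^ r = 1 -> r = 0.
  move=> r s /= rs; apply/eqP; rewrite -subr_eq0; apply/eqP; apply: E.
  by rewrite expfzDr // rs -expfzDr // subrr.
case: r => [[//|n]|n] H; first by have := q_root (ltn0Sn n);
  rewrite -[q ^+ _]/(q ^ n.+1) H eqxx.
have := q_root (ltn0Sn n); rewrite -[q ^+ _]invrK.
by rewrite -[(q ^+ _)^-1]/(q ^ Negz n) H invr1 eqxx.
Qed.

Lemma local_quadrant u v w : exists rs : seq int,
  quadrant (lin2s (map (fun r => q ^ r) rs) (prd u v w)).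
Proof.
have [rs H] := equivariant_local W_equiv u v; exists rs.
by rewrite -poly_act2_prod; apply: (field2_quadrant w H).
Qed.

Lemma bounded_above_line u v w s : bounded_above (line s (prd u v w)).
Proof.
have [N HN] := (phi_field W_mod v).2 w; exists (s - N) => m mN.
by rewrite /line /prd /product_coef HN ?(linear_0 (YW_linearr W_mod u m)) //; lia.
Qed.

Lemma bounded_below_rev_line u v w s :
  bounded_below (fun m => line s (prd u v w) (s - m)).
Proof.
have [N HN] := (phi_field W_mod v).2 w; exists N => m mN.
by rewrite /line /prd /product_coef subKr HN ?(linear_0 (YW_linearr W_mod u _)).
Qed.

Lemma quadrant_fsupp T A s : quadrant (lin2s T A) ->
  fsupp (lin1s T (line s A) : int -> W).
Proof. by move=> qT; rewrite -line_lin2s; apply: quadrant_line. Qed.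

(** Both sides are Laurent polynomials, hence determined by their expansions at
    x = e^z.  These are given by associativity for (u, v) and for (v, u), and agree by
    skew-symmetry. *)
Lemma quasi_commute T u v w s : 0 \notin T ->
  quadrant (lin2s T (prd u v w)) ->
    quadrant (lin2s (map (fun y => y^-1) T) (prd v u w)) ->
  lin1s T (line s (prd u v w)) = lin1s T (fun m => line s (prd v u w) (s - m)).
Proof.
move=> T0 qA qC; set T' := map _ T in qC.
have fA := quadrant_fsupp s qA; have fC := quadrant_fsupp s qC.
set k := \prod_(y <- T) - y.
pose cB m := k *: lin1s T' (line s (prd v u w)) (s + (size T)%:Z - m).
have EB : lin1s T (fun m => line s (prd v u w) (s - m)) = cB by rewrite lin1s_rev.
have fB' := fsupp_rev (s + (size T)%:Z) fC.
have fB : fsupp cB by apply: (fsuppZ (fun=> k)).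
rewrite EB; have [K HK] := iterate_coef_vanish Y_va W_mod v u w.
have E : at_exp (lin1s T (line s (prd u v w))) = at_exp cB.
  rewrite (product_iterate_line Y_va W_mod qA) (iterate_coef_skew Y_va W_mod)
    -(lins_exp_rev s T0 (HK s)).
  apply: funext => l; rewrite -(product_iterate_line Y_va W_mod qC) -(at_exp_rev _ fC).
  have := at_exp_linear k 0 fB' fB' l; rewrite scale0r addr0 => <-.
  by apply: eq_at_exp => m; rewrite scale0r addr0.
apply: funext => m; apply/eqP; rewrite -subr_eq0; apply/eqP; move: m.
have := at_exp_linear 1 (-1) fA fB; rewrite E => D.
have fD := fsuppDZ 1 (-1) fA fB.
move=> m; have := at_exp_inj fD _ m; rewrite scale1r scaleN1r; apply => l.
by rewrite D scale1r scaleN1r subrr.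
Qed.

(** Since Y_W(tau_r u, x) = Y_W(u, q^r x), the expansion at x = q^r e^z for u is
    the expansion at x = e^z for tau_r u. *)
Lemma product_at_qpower T u v w s r : quadrant (lin2s T (prd u v w)) ->
  at_pt_exp (q ^ r) (lin1s T (line s (prd u v w)))
  = lins_exp (q ^ r) T (fun k => iterate_coef Y YW (tau r u) v w k s).
Proof.
move=> qT; set x := q ^ r; have x0 : x != 0 := qexp_neq0 r.
have prdE : prd (tau r u) v w = fun m n => x ^ m *: prd u v w m n.
  apply: funext => m; apply: funext => n.
  by rewrite /prd /product_coef (equivariant_tau W_equiv).
have qT' := quadrant_scale x0 qT; rewrite -prdE in qT'.
have [K HK] := iterate_coef_vanish Y_va W_mod (tau r u) v w.
rewrite (lins_exp_scale T x0 (HK s)) -(product_iterate_line Y_va W_mod qT') /at_pt_exp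
  rescale_lin1s //.
have fT' := quadrant_fsupp s qT'.
have -> : rescale x (line s (prd u v w)) = line s (prd (tau r u) v w) by rewrite prdE.
apply: funext => k; have := at_exp_linear (x ^+ size T) 0 fT' fT' k;
  rewrite scale0r addr0 => <-.
by apply: eq_at_exp => m; rewrite scale0r addr0.
Qed.

(** The two products are the expansions of one rational function, whose pole at q^r
    has the polar coefficients (tau_r u)_0 v and (tau_r u)_1 v. *)
Lemma commutator u v (E : seq int) : uniq E ->
  (forall r n, 2 <= n -> Y (tau r u) n v = 0) ->
  (forall r, r \notin E -> Y (tau r u) 0 v = 0 /\ Y (tau r u) 1 v = 0) ->
  forall m n w, YW u m (YW v n w) - YW v n (YW u m w) =
  \sum_(r <- E) (q ^ r) ^ (- m) *:
    (YW (Y (tau r u) 0 v) (m + n) w - m%:~R *: YW (Y (tau r u) 1 v) (m + n) w).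
Proof.
move=> uE Y2 YE m n w; pose s := m + n.
have [rs1 q1] := local_quadrant u v w; have [rs2 q2] := local_quadrant v u w.
pose f (r : int) := q ^ r.
(* The signs come from x2 - q^r x1 = - q^r (x1 - q^-r x2). *)
pose T0 := rs1 ++ map (fun r => - r) rs2 ++ E.
(* Every pole is listed at least twice, as the iterates have poles of order 2. *)
pose T := map f (T0 ++ T0).
have T_n0 : 0 \notin T by apply/mapP => -[r _ /eqP];
  rewrite eq_sym (negPf (qexp_neq0 r)).
have qA : quadrant (lin2s T (prd u v w)).
  have pT : perm_eq T (map f (map (fun r => - r) rs2 ++ E ++ T0) ++ map f rs1).
    by rewrite -map_cat perm_map // /T0 -catA perm_catC -!catA.
  by rewrite (lin2s_perm _ pT); apply: quadrant_lin2s_cat.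
have qC : quadrant (lin2s (map (fun y => y^-1) T) (prd v u w)).
  have pT : perm_eq (map (fun y => y^-1) T)
      (map (fun y => y^-1) (map f (rs1 ++ E ++ T0)) ++ map f rs2).
    have -> : map f rs2 = map (fun y => y^-1) (map f (map (fun r => - r) rs2)).
      rewrite -!map_comp; apply: eq_map => r /=.
      by rewrite /f -exprz_inv expfV invrK.
    by rewrite -!map_cat !perm_map // /T0 -!catA perm_cat2l perm_catC -!catA.
  by rewrite (lin2s_perm _ pT); apply: quadrant_lin2s_cat.
have AB := quasi_commute s T_n0 qA qC.
have fT r : r \in T0 -> f r \in T by move=> rT; rewrite map_f // mem_cat rT.
(* rt is the logarithm to base q on the poles. *)
pose rt x := nth 0 T0 (index x (map f T0)).
have rtE r : r \in T0 -> rt (f r) = r.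
  by move=> rT; rewrite /rt (index_map qexp_inj) nth_index.
have Tf x : x \in T -> exists2 r, r \in T0 & x = f r.
  by move=> /mapP[r]; rewrite mem_cat orbb => rT ->; exists r.
pose a x := YW (Y (tau (rt x) u) 0 v) s w.
pose b x := YW (Y (tau (rt x) u) 1 v) s w.
have T2 x : x \in T -> (2 <= count_mem x T)%N.
  move=> /Tf[r rT ->]; rewrite /T map_cat count_cat.
  have : (0 < count_mem (f r) (map f T0))%N by rewrite -has_count has_pred1 map_f.
  by lia.
have res := @residue_formula _ _ T _ _ a b T_n0 (bounded_above_line u v w s) (bounded_below_rev_line v u w s) AB T2.
have {res} := res _ m; rewrite /line subKr /prd /product_coef (_ : s - m = n);
  last by rewrite /s; lia.
move=> -> => [|x /Tf[r rT ->]]; last first.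
  exists (fun k => iterate_coef Y YW (tau r u) v w k s); split.
  - move=> k k2; rewrite /iterate_coef Y2 ?(linear_0 (YW_linearl W_mod s w)) //; lia.
  - by rewrite /a rtE.
  - by rewrite /b rtE.
  - exact: product_at_qpower.
pose G r : W := (q ^ r) ^ (- m) *:
    (YW (Y (tau r u) 0 v) s w - m%:~R *: YW (Y (tau r u) 1 v) s w).
transitivity (\sum_(r <- undup T0) G r).
  transitivity (\sum_(x <- map f (undup T0)) x ^ (- m) *: (a x - m%:~R *: b x)).
    apply: perm_big; apply: uniq_perm; first exact: undup_uniq.
      by rewrite (map_inj_uniq qexp_inj) undup_uniq.
    move=> x; rewrite mem_undup; apply/idP/mapP => [/Tf[r rT ->]|[r rT ->]].
      by exists r => //; rewrite mem_undup.
    by apply: fT; rewrite -mem_undup.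
  rewrite big_map; apply: eq_big_seq => r; rewrite mem_undup => rT.
  by rewrite /a /b rtE.
rewrite (bigID (fun r => r \in E)) /= [X in _ + X]big1 ?addr0 => [|r rE].
  rewrite -big_filter; apply: perm_big; apply: uniq_perm => //.
    by rewrite filter_uniq ?undup_uniq.
  move=> r; rewrite mem_filter mem_undup /T0 !mem_cat.
  by case: (r \in E); rewrite ?orbT.
have [Y0 Y1] := YE r rE; rewrite /G Y0 Y1 (linear_0 (YW_linearl W_mod s w)).
by rewrite scaler0 subr0 scaler0.
Qed.

End Commutator.

(** * The action of the q-difference operators *)

Section QDifference.
Context {F : numFieldType}.
Variables (q l1 l2 : F).
Variable (Y : VA l1 l2 -> int -> VA l1 l2 -> VA l1 l2).
Variables (W : lmodType F) (YW : VA l1 l2 -> int -> W -> W).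
Hypothesis q0 : q != 0.
Hypothesis q_root : forall n : nat, (0 < n)%N -> q ^+ n != 1.
Hypothesis Y_va : vertex_algebra (VA_vac l1 l2) Y.
Hypothesis Y_gen : forall (a : algA F) (n : int) (v : VA l1 l2),
  Y (VA_in l1 l2 a) n v = VA_act (tens a n) v.
Hypothesis W_mod : phi_quasi_module (VA_vac l1 l2) Y YW.
Hypothesis W_equiv : equivariant q (@VA_tau _ l1 l2) YW.

Let VG a m : VA l1 l2 := VA_in l1 l2 (G a m).
Let vac := VA_vac l1 l2.

Lemma VA_act_linearl w : linear (fun x => VA_act x w : VA l1 l2).
Proof. exact: (lie_module_linearl (VA_lie_module l1 l2) w). Qed.

Lemma tau_VG r a m : VA_tau r (VG a m) = VG a (m + r).
Proof. by rewrite /VG /VA_in VA_tau_act VA_tau_vac tau_tensG. Qed.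

Lemma tens_comb c d a m b n i :
  tens (c *: G a m - d *: G b n) i = c *: tens (G a m) i - d *: tens (G b n) i :> affA F.
Proof.
have tl := @tens_linear F i.
by rewrite (linear_B tl); congr (_ - _); apply: (linear_Z tl).
Qed.

Lemma VG_act_vac (n : nat) a m b k :
  Y (VG a m) n (VG b k) =
  VA_act (br_affA (tens (G a m) n) (tens (G b k) (-1))) vac.
Proof.
rewrite /VG Y_gen /VA_in (lie_module_bracket (VA_lie_module l1 l2)).
rewrite [in RHS](VA_tens_vac l1 l2 a m n).
by rewrite (linear_0 (lie_module_linearr (VA_lie_module l1 l2) _)) subr0.
Qed.

(** The products of nonnegative index are read off the affine bracket, because
    G_{a,m} t^n kills the vacuum for n >= 0. *)
Lemma VG_prod0 a m b k : Y (VG a m) 0 (VG b k) =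
  (a + b == m - k)%:R *: VG (a + b) (a + k)
  - (a + b == k - m)%:R *: VG (a + b) (k - a)
  + (a%:~R * ((a + b == 0) && (m - k == 0))%:R * l1) *: vac.
Proof.
rewrite (VG_act_vac 0) br_affA_tensG psiA_G brA_G.
rewrite -[0%:Z + -1 + 1 == 0]/true -[0%:Z + -1]/(- 1 : int) mulr1 !mul0r scale0r addr0.
rewrite !(linear_D (VA_act_linearl vac)) !(linear_Z (VA_act_linearl vac)) VA_K1_vac
  scalerA.
congr (_ + _); rewrite tens_comb (linear_B (VA_act_linearl vac)).
by rewrite !(linear_Z (VA_act_linearl vac)).
Qed.

Lemma VG_prod1 a m b k : Y (VG a m) 1 (VG b k) =
  (((a + b == 0) && (m - k == 0))%:R * l2) *: vac.
Proof.
rewrite (VG_act_vac 1) br_affA_tensG formA_G brA_G.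
rewrite -[1%:Z + -1 + 1 == 0]/false -[1%:Z + -1]/(0 : int) mulr0 scale0r addr0 eqxx
  mulr1 mul1r.
rewrite !(linear_D (VA_act_linearl vac)) !(linear_Z (VA_act_linearl vac)) VA_K2_vac
  scalerA.
rewrite tens_comb (linear_B (VA_act_linearl vac)) !(linear_Z (VA_act_linearl vac)).
by rewrite !(VA_tens_vac l1 l2 _ _ 0) !scaler0 subr0 add0r.
Qed.

Lemma VG_prod2 a m b k (n : int) : 2 <= n -> Y (VG a m) n (VG b k) = 0.
Proof.
case: n => // -[//|[//|n]] _.
rewrite (VG_act_vac n.+2) br_affA_tensG brA_G.
have -> : (n.+2%:Z + -1 + 1 == 0) = false by lia.
have -> : (n.+2%:Z + -1 == 0) = false by lia.
have -> : n.+2%:Z + -1 = n.+1%:Z by lia.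
rewrite !mulr0 !scale0r !addr0.
rewrite tens_comb (linear_B (VA_act_linearl vac)) !(linear_Z (VA_act_linearl vac)).
by rewrite !(VA_tens_vac l1 l2 _ _ n.+1) !scaler0 subr0.
Qed.

Lemma VG_prod00 a r b : Y (VG a r) 0 (VG b 0) =
  (r == a + b)%:R *: VG (a + b) a - (r == - (a + b))%:R *: VG (a + b) (- a)
  + (a%:~R * ((a + b == 0) && (r == 0))%:R * l1) *: vac.
Proof.
have e1 : (a + b == r - 0) = (r == a + b) by lia.
have e2 : (a + b == 0 - r) = (r == - (a + b)) by lia.
have e3 : (r - 0 == 0) = (r == 0) by lia.
have e4 : a + 0 = a by lia.
have e5 : 0 - a = - a by lia.
by rewrite VG_prod0 e1 e2 e3 e4 e5.
Qed.

Lemma VG_prod10 a r b : Y (VG a r) 1 (VG b 0) =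
  (((a + b == 0) && (r == 0))%:R * l2) *: vac.
Proof.
have e3 : (r - 0 == 0) = (r == 0) by lia.
by rewrite VG_prod1 e3.
Qed.

(** The operator of E_{k,-n}, except that [mode 0 0] is the operator zeta. *)
Definition mode k n : W -> W := YW (VG k 0) n.

Lemma mode_linear k n : linear (mode k n).
Proof. exact: YW_linearr W_mod (VG k 0) n. Qed.

Lemma YW_VG k m n w : YW (VG k m) n w = (q ^ m) ^ n *: mode k n w.
Proof. by rewrite -[m]add0r -tau_VG (equivariant_tau W_equiv) add0r. Qed.

Lemma linear_comb3 (V U : lmodType F) (f : V -> U) (c d e : F) x y z : linear f ->
  f (c *: x - d *: y + e *: z) = c *: f x - d *: f y + e *: f z.
Proof. by move=> fl; rewrite (linear_D fl) (linear_B fl) !(linear_Z fl). Qed.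

Lemma comb3_0 (V : lmodType F) (x y z : V) :
  false%:R *: x - false%:R *: y + (0 : F) *: z = 0.
Proof. by rewrite !scale0r subr0 addr0. Qed.

Lemma sum_delta (E : seq int) c (x : W) : uniq E -> c \in E ->
  \sum_(r <- E) (r == c)%:R *: x = x.
Proof.
move=> uE cE; rewrite (bigD1_seq c) //= eqxx scale1r big1 ?addr0 // => r /negPf->.
by rewrite scale0r.
Qed.

Lemma sum_delta3 (E : seq int) c d e (x y z : W) : uniq E ->
  c \in E -> d \in E -> e \in E ->
  \sum_(r <- E) ((r == c)%:R *: x - (r == d)%:R *: y + (r == e)%:R *: z) = x - y + z.
Proof. by move=> uE cE dE eE; rewrite big_split sumrB /= !sum_delta. Qed.

Lemma delta_if (b c : bool) (z : F) (w : W) :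
  b%:R *: (z *: (if c then w else 0)) = (b && c)%:R *: (z *: w).
Proof. by case: c; rewrite ?andbT // andbF !scaler0 scale0r. Qed.

(** The two nonzero values of the bracket of G_{a,r} and G_{b,0} occur at the
    poles r = a + b and r = -(a + b), and the cocycle and the form contribute at r = 0.
    Writing G_{a+b,a} and G_{a+b,-a} as translates of G_{a+b,0} brings out the exponents
    of q. *)
Lemma mode_commutator a m b n w :
  mode a m (mode b n w) - mode b n (mode a m w) =
  (q ^ (a * n - b * m) - q ^ (b * m - a * n)) *: mode (a + b) (m + n) w
  + ((a + b == 0) && (m + n == 0))%:R *: ((a%:~R * l1 - m%:~R * l2) *: w).
Proof.
pose E := undup [:: a + b; - (a + b); 0].
have := @commutator F (VA l1 l2) W _ Y YW q _ Y_va W_mod W_equiv q0 q_root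
  (VG a 0) (VG b 0) E (undup_uniq _).
have Y2 r k : 2 <= k -> Y (VA_tau r (VG a 0)) k (VG b 0) = 0.
  by move=> k2; rewrite tau_VG VG_prod2.
move=> /(_ Y2) H; rewrite /mode H {H}; last first.
  move=> r; rewrite mem_undup !inE !negb_or => /and3P[r1 r2 r3].
  rewrite tau_VG add0r VG_prod00 VG_prod10 (negPf r1) (negPf r2) (negPf r3).
  rewrite !andbF mulr0 !mul0r.
  by split; [exact: comb3_0 | exact: scale0r].
set s := m + n.
have vl := YW_linearl W_mod s w.
pose T1 := (q ^ (a + b)) ^ (- m) *: YW (VG (a + b) a) s w.
pose T2 := (q ^ (- (a + b))) ^ (- m) *: YW (VG (a + b) (- a)) s w.
pose T3 := (a + b == 0)%:R *: ((a%:~R * l1 - m%:~R * l2) *: YW vac s w).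
transitivity (\sum_(r <- E) ((r == a + b)%:R *: T1 - (r == - (a + b))%:R *: T2 + (r == 0)%:R *: T3)).
  apply: eq_bigr => r _; rewrite tau_VG add0r VG_prod00 VG_prod10.
  rewrite (linear_comb3 _ _ _ _ _ _ vl) (linear_Z vl (_ * l2)).
  rewrite -addrA scalerDr scalerBr; congr (_ - _ + _).
  - by case: eqP => [->|_]; rewrite ?scale1r // !scale0r scaler0.
  - by case: eqP => [->|_]; rewrite ?scale1r // !scale0r scaler0.
  rewrite /T3; case: (r =P 0) => [->|_].
    rewrite andbT expr0z exp1rz !scale1r; case: (a + b == 0).
      by rewrite mulr1 mul1r scale1r scalerA -scalerBl.
    by rewrite mulr0 !mul0r !scale0r scaler0 subr0.
  by rewrite andbF mulr0 !mul0r !scale0r scaler0 subr0 scaler0.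
have uE : uniq E := undup_uniq _.
have E1 : a + b \in E by rewrite mem_undup !inE eqxx.
have E2 : - (a + b) \in E by rewrite mem_undup !inE eqxx orbT.
have E3 : 0 \in E by rewrite mem_undup !inE !orbT.
have eT1 : T1 = q ^ (a * n - b * m) *: mode (a + b) s w.
  rewrite /T1 YW_VG scalerA !exprz_exp -expfzDr //.
  by congr (q ^ _ *: _); rewrite /s; ring.
have eT2 : T2 = q ^ (b * m - a * n) *: mode (a + b) s w.
  rewrite /T2 (YW_VG (a + b) (- a) s w).
  rewrite scalerA.
  rewrite (exprz_exp q (- (a + b))).
  rewrite (exprz_exp q (- a)).
  rewrite -(expfzDr _ _ q0).
  by congr (q ^ _ *: _); rewrite /s; ring.
rewrite (sum_delta3 _ _ _ uE E1 E2 E3) eT1 eT2 -scalerBl; congr (_ + _);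
  rewrite /T3 (phi_vac W_mod).
exact: delta_if.
Qed.

Definition qact_basis (i : {kl : int * int | kl != (0, 0)} + bool) : W -> W :=
  match i with
  | inl kl => mode (val kl).1 (- (val kl).2)
  | inr false => fun w => l1 *: w
  | inr true => fun w => l2 *: w
  end.

Lemma qact_basis_linear i : linear (qact_basis i).
Proof.
case: i => [kl|[]] c x y /=; first exact: mode_linear.
- by rewrite scalerDr !scalerA mulrC.
- by rewrite scalerDr !scalerA mulrC.
Qed.

Definition qact (x : qdiff F) (w : W) : W := lext (fun i => qact_basis i w) x.

Lemma qact_linearl w : linear (qact^~ w).
Proof. exact: lext_is_linear. Qed.

Lemma qact_linearr x : linear (qact x).
Proof.
move=> c u v; rewrite /qact !lextE scaler_sumr -big_split; apply: eq_bigr => i _ /=.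
by rewrite qact_basis_linear scalerDr !scalerA mulrC.
Qed.

Lemma qact_bas i w : qact (bas i) w = qact_basis i w.
Proof. exact: lextU. Qed.

Lemma qact_c1 w : qact c1 w = l1 *: w. Proof. exact: qact_bas. Qed.
Lemma qact_c2 w : qact c2 w = l2 *: w. Proof. exact: qact_bas. Qed.

Lemma qact_E k l w : qact (E k l) w =
  if (k == 0) && (l == 0) then 0 else mode k (- l) w.
Proof.
rewrite /E; case: insubP => [kl|]; last first.
  rewrite negbK xpair_eqE => /= ->.
  exact: (linear_0 (qact_linearl w)).
by rewrite xpair_eqE qact_bas /= => /negPf -> ->.
Qed.

Lemma br_qdiff_bas kl rs : br_qdiff q (bas (inl kl)) (bas (inl rs)) =
  (q ^ ((val rs).1 * (val kl).2 - (val rs).2 * (val kl).1)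
   - q ^ ((val rs).2 * (val kl).1 - (val rs).1 * (val kl).2))
    *: E ((val kl).1 + (val rs).1) ((val kl).2 + (val rs).2)
  + (((val kl).1 == - (val rs).1) && ((val kl).2 == - (val rs).2))%:R *:
    ((val kl).1%:~R *: c1 + (val kl).2%:~R *: c2) :> qdiff F.
Proof. by rewrite /br_qdiff bilinU; case: kl rs => [[k l] ?] [[r s] ?]. Qed.

(** The relation between E_{k,l} and E_{-k,-l} would involve [mode 0 0], but its
    coefficient q^0 - q^0 is zero, in accordance with E_{0,0} = 0. *)
Lemma qact_bracket x y w :
  qact (br_qdiff q x y) w = qact x (qact y w) - qact y (qact x w).
Proof.
have bl z : linear ((br_qdiff q)^~ z) := bilin_linearl _ z.
have br z : linear (br_qdiff q z) := bilin_linearr _ z.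
have central (b : bool) z :
  qact (bas (inr b)) (qact z w) = qact z (qact (bas (inr b)) w).
  by rewrite !qact_bas; case: b => /=; rewrite (linear_Z (qact_linearr z)).
have kl (b : bool) z : br_qdiff q (bas (inr b)) z = 0.
  apply: (linear_ext (g := fun=> 0)) => [|c u v|k]; first exact: br.
  - by rewrite scaler0 addr0.
  - by rewrite /br_qdiff bilinU.
have kr (b : bool) z : br_qdiff q z (bas (inr b)) = 0.
  apply: (linear_ext (f := (br_qdiff q)^~ (bas (inr b))) (g := fun=> 0)).
  - exact: bl.
  - by move=> c u v; rewrite scaler0 addr0.
  - by move=> [?|?]; rewrite /br_qdiff bilinU.
apply: (linear_ext (f := fun x => qact (br_qdiff q x y) w)
  (g := fun x => qact x (qact y w) - qact y (qact x w))) => [c u v|c u v|].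
- by rewrite bl qact_linearl.
- by rewrite !qact_linearl qact_linearr scalerBr opprD addrACA.
move=> [i|b]; last by rewrite kl central subrr (linear_0 (qact_linearl w)).
apply: (linear_ext (f := fun y => qact (br_qdiff q (bas (inl i)) y) w)
  (g := fun y => qact (bas (inl i)) (qact y w) - qact y (qact (bas (inl i)) w))) => [c u v|c u v|].
- by rewrite br qact_linearl.
- by rewrite !qact_linearl qact_linearr scalerBr opprD addrACA.
move=> [j|b]; last by rewrite kr central subrr (linear_0 (qact_linearl w)).
rewrite br_qdiff_bas !qact_bas /=.
case: i j => [[k l] /= ?] [[r s] /= ?]; rewrite mode_commutator.
rewrite (linear_D (qact_linearl w)) !(linear_Z (qact_linearl w))
  (linear_D (qact_linearl w)).
rewrite !(linear_Z (qact_linearl w)) qact_c1 qact_c2 qact_E !scalerA -scalerDl.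
rewrite -[X in _ = _ + X]scalerA; congr (_ + _ *: (_ *: _)).
- have [/andP[kr0 ls0]|_] := boolP ((k + r == 0) && (l + s == 0)); last first.
    congr ((q ^ _ - q ^ _) *: _); try ring.
    by rewrite opprD.
  have -> : r = - k by lia.
  have -> : s = - l by lia.
  have -> : k * - - l - - k * - l = - k * - l - k * - - l by ring.
  by rewrite subrr scale0r scaler0.
- by congr ((_ && _)%:R); lia.
- by rewrite rmorphN mulNr opprK.
Qed.

(** The operator zeta is the constant term of Y_W(G_{0,0}, x), for which there is no
    E_{0,0}; it is central because every term of [mode_commutator] vanishes for
    a = m = 0. *)
Lemma qdiff_module_exists :
  exists (act : qdiff F -> W -> W) (zeta : W -> W),
    [/\ restricted_qdiff_module q l1 l2 act,
        forall x w, act x (zeta w) = zeta (act x w)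
      & forall (k m n : int) (w : W),
          YW (VA_in l1 l2 (G k m)) n w
          = Etilde q act k m n w + (if (k == 0) && (n == 0) then zeta w else 0)].
Proof.
exists qact, (mode 0 0); split.
- split.
  + by split; [exact: qact_linearl | exact: qact_linearr | exact: qact_bracket].
  + move=> w k; have [N HN] := (phi_field W_mod (VG k 0)).2 w.
    exists (1 - N) => l lN; rewrite qact_E; case: ifP => // _.
    by rewrite /mode HN //; lia.
  + exact: qact_c1.
  + exact: qact_c2.
- move=> x w; apply: (linear_ext (f := fun x => qact x (mode 0 0 w))
    (g := fun x => mode 0 0 (qact x w))) => [|c u v|[kl|[]]].
  + exact: qact_linearl.
  + by rewrite qact_linearl mode_linear.
  + rewrite !qact_bas /=; apply/esym/eqP; rewrite -subr_eq0 mode_commutator.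
    by rewrite !mul0r !mulr0 !subrr !scale0r scaler0 addr0.
  + by rewrite !qact_bas /= (linear_Z (mode_linear 0 0)).
  + by rewrite !qact_bas /= (linear_Z (mode_linear 0 0)).
- move=> k m n w; rewrite -/(VG k m) YW_VG /Etilde qact_E opprK oppr_eq0.
  case: ifP => [/andP[/eqP-> /eqP->]|_]; last by rewrite addr0.
  by rewrite expr0z scale1r scaler0 add0r.
Qed.

End QDifference.

Theorem theorem4p2 (R : realType) (q l1 l2 : R[i])
  (q_neq0 : q != 0)
  (q_not_root : forall n : nat, (0 < n)%N -> q ^+ n != 1)
  (Y : VA l1 l2 -> int -> VA l1 l2 -> VA l1 l2)
  (Y_va : vertex_algebra (VA_vac l1 l2) Y)
  (Y_gen : forall (a : algA R[i]) (n : int) (v : VA l1 l2),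
     Y (VA_in l1 l2 a) n v = VA_act (tens a n) v)
  (W : lmodType R[i]) (YW : VA l1 l2 -> int -> W -> W)
  (W_module : phi_quasi_module (VA_vac l1 l2) Y YW)
  (W_equivariant : equivariant q (@VA_tau _ l1 l2) YW) :
  exists (act : qdiff R[i] -> W -> W) (zeta : W -> W),
    [/\ restricted_qdiff_module q l1 l2 act,
        forall x w, act x (zeta w) = zeta (act x w)
      & forall (k m n : int) (w : W),
          YW (VA_in l1 l2 (G k m)) n w
          = Etilde q act k m n w + (if (k == 0) && (n == 0) then zeta w else 0)].
Proof. exact: (qdiff_module_exists q_neq0 q_not_root Y_va Y_gen W_module W_equivariant). Qed.
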